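(* Consider $N$ fully actuated Euler-Lagrange agents $M_i(q_i)\ddot q_i+C_i(q_i,\dot q_i)\dot q_i+g_i(q_i)=f_i$, $q_i\in\mathbb{R}^n$, $i=1,\dots,N$, with unbounded actuation and uncertain constant parameter vectors $\theta_i$, under the adaptive control $$f_i=\Phi_i(q_i,\dot q_i,e_i,\dot e_i)\hat\theta_i-\mu_is_i-\kappa_i\dot q_i,\qquad \dot{\hat\theta}_i=-\Phi_i^{\mathsf T}(q_i,\dot q_i,e_i,\dot e_i)s_i,$$ where $e_i=\sum_{j\in\mathcal{N}_i(0)}\nabla_i\psi(\|q_{ij}\|)$, $s_i=\dot q_i+\alpha e_i$, and $\alpha,\mu_i,\kappa_i>0$ are constants, with a generalized potential $\psi,\Psi,\Psi_{max}$ as in the context. Suppose the initial communication graph is undirected and connected, that there is $\epsilon>0$ with $\|q_{ij}(0)\|\le r-\epsilon$ for all $(i,j)\in\mathcal{E}(0)$, and that $\Psi(q(0))<\Psi_{max}$; the initial velocities $\dot q_i(0)$ and initial estimates $\hat\theta_i(0)$ are arbitrary. Then: (a) if $\Psi_{max}=\infty$, for all $\alpha,\mu_i,\kappa_i>0$, (b) if $\Psi_{max}<\infty$, for all $\alpha,\mu_i>0$ and all sufficiently large $\kappa_i$ (depending on the initial state, $\alpha$ and the initial estimation error), the closed loop achieves connectivity-preserving consensus: $\|q_i(t)-q_j(t)\|<r$ for all $t\ge0$ and $(i,j)\in\mathcal{E}(0)$, and $q_i(t)-q_j(t)\to0$ as $t\to\infty$ for all $i,j$.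
   Context: All agents have communication radius $r>0$; $\mathcal{E}(0)$ is the initial edge set and $\mathcal{N}_i(0)=\{j:(i,j)\in\mathcal{E}(0)\}$. Put $q_{ij}=q_j-q_i$; $\nabla_i$ is the gradient with respect to $q_i$. Euler-Lagrange dynamics: $M_i$ (inertia), $C_i$ (Coriolis/centrifugal), $g_i$ (gravity) are smooth functions with P1. $M_i(q_i)$ symmetric and $0\prec\lambda_{i1}I\preceq M_i(q_i)\preceq\lambda_{i2}I$ for constants $\lambda_{i1},\lambda_{i2}>0$; P2. $\dot M_i(q_i)-2C_i(q_i,\dot q_i)$ skew-symmetric; P3. there is a constant $\bar c_i>0$ with $\|C_i(q_i,\dot q_i)y\|\le \bar c_i\|\dot q_i\|\|y\|$ for all $q_i,\dot q_i,y$; P4. the dynamics are linear in a constant parameter vector $\theta_i$; in particular there is a known regressor matrix $\Phi_i$ with $\Phi_i(q_i,\dot q_i,e_i,\dot e_i)\theta_i=M_i(q_i)(-\alpha\dot e_i)+C_i(q_i,\dot q_i)(-\alpha e_i)+g_i(q_i)$ for the true $\theta_i$. $\hat\theta_i$ is the estimate of $\theta_i$, and $\tilde\theta_i=\theta_i-\hat\theta_i$ is the estimation error. Generalized potential: $\Psi(q)=\frac12\sum_{i=1}^N\sum_{j\in\mathcal{N}_i(0)}\psi(\|q_{ij}\|)$, where $\psi:[0,r]\to[0,+\infty]$ is continuous, finite on $[0,r)$, and 1. $\psi(s)=0\Leftrightarrow s=0$; 2. as a function of $s^2$, $\psi$ is smooth on $[0,r)$ with positive first derivative; 3. there is $\Psi_{max}\in(0,+\infty]$,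 not necessarily finite, with $\Psi(q)\ge\Psi_{max}$ whenever $\|q_{ij}\|\le r$ for all $(i,j)\in\mathcal{E}(0)$ and $\|q_{ij}\|=r$ for some $(i,j)\in\mathcal{E}(0)$. *)

(* Defs.v *)
From HB Require Import structures.
From mathcomp Require Import all_boot all_order all_algebra.
From mathcomp Require Import all_classical all_reals all_analysis.

Set Implicit Arguments.
Unset Strict Implicit.
Unset Printing Implicit Defensive.

Import Order.TTheory GRing.Theory Num.Theory.
Import numFieldNormedType.Exports.

Local Open Scope classical_set_scope.
Local Open Scope ring_scope.

Section Analysis.
Context {R : realType}.

(* Euclidean norm; the library norm `|x| on matrices is the sup norm (it
   induces the same topology, so limits and derivatives are unaffected). *)
Definition enorm m (x : 'cV[R]_m) : R := Num.sqrt (\sum_k x k 0 ^+ 2).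

Definition grad m (F : 'cV[R]_m -> R) (x : 'cV[R]_m) : 'cV[R]_m :=
  \col_k 'D_(delta_mx k 0) F x.

(* C^k on an open set U.  All spaces used here are finite-dimensional, where
   continuity of all directional derivatives is continuity of the differential. *)
Fixpoint Ck (V W : normedModType R) (k : nat) (U : set V) (f : V -> W) : Prop :=
  match k with
  | 0%N => forall x, U x -> {for x, continuous f}
  | k'.+1 => (forall x, U x -> differentiable f x) /\
             forall w, Ck k' U (fun x => 'D_w f x)
  end.

Definition smooth (V W : normedModType R) (U : set V) (f : V -> W) : Prop :=
  forall k, Ck k U f.

Definition loewner_le n (A B : 'M[R]_n) : Prop :=
  forall x : 'cV[R]_n, 0 <= (x^T *m (B - A) *m x) 0 0.

Definition skew_symmetric n (A : 'M[R]_n) : Prop := A^T = - A.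

End Analysis.

Section Agents.
Context {R : realType} (n : nat).

(* In P2 the time derivative of M(q) along a motion with position q and
   velocity v is the directional derivative of M at q along v. *)
Record euler_lagrange (M : 'cV[R]_n -> 'M[R]_n)
    (C : 'cV[R]_n -> 'cV[R]_n -> 'M[R]_n) (g : 'cV[R]_n -> 'cV[R]_n) : Prop := {
  el_smooth_M : smooth setT M ;
  el_smooth_C : smooth setT (fun z : 'cV[R]_n * 'cV[R]_n => C z.1 z.2) ;
  el_smooth_g : smooth setT g ;
  el_P1_sym : forall q, (M q)^T = M q ;
  el_P1_bounds : exists l1 l2 : R, [/\ 0 < l1, 0 < l2 &
    forall q, loewner_le l1%:M (M q) /\ loewner_le (M q) l2%:M] ;
  el_P2 : forall q v, skew_symmetric ('D_v M q - 2 *: C q v) ;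
  el_P3 : exists2 c : R, 0 < c &
    forall q v y, enorm (C q v *m y) <= c * enorm v * enorm y
}.

Definition regressor m (alpha : R) (M : 'cV[R]_n -> 'M[R]_n)
    (C : 'cV[R]_n -> 'cV[R]_n -> 'M[R]_n) (g : 'cV[R]_n -> 'cV[R]_n)
    (theta : 'cV[R]_m)
    (Phi : 'cV[R]_n -> 'cV[R]_n -> 'cV[R]_n -> 'cV[R]_n -> 'M[R]_(n, m)) : Prop :=
  forall q v e de, Phi q v e de *m theta =
    M q *m (- alpha *: de) + C q v *m (- alpha *: e) + g q.

End Agents.

Section Network.
Context {R : realType} (N n : nat).
Variables (E : rel 'I_N) (r : R) (psi : R -> \bar R).
Implicit Types q : 'I_N -> 'cV[R]_n.

Definition Psi q : \bar R :=
  ((2^-1)%:E * \sum_(i < N) \sum_(j < N | E i j) psi (enorm (q j - q i)))%E.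

(* psi is only meaningful on [0, r]; its values elsewhere are unconstrained.
   "Smooth as a function of s^2" on [0, r) is smoothness of sigma, with
   psi s = sigma (s^2), on the non-open set [0, r^2), i.e. on an open
   neighbourhood U of it. *)
Record generalized_potential (Psimax : \bar R) : Prop := {
  gp_ge0 : forall s : R, 0 <= s <= r -> (0 <= psi s)%E ;
  gp_continuous : {within [set s : R | 0 <= s <= r], continuous psi} ;
  gp_finite : forall s : R, 0 <= s < r -> psi s \is a fin_num ;
  gp_eq0 : forall s : R, 0 <= s <= r -> (psi s = 0%E <-> s = 0) ;
  gp_smooth : exists (U : set R) (sigma : R -> R),
    [/\ open U, [set u : R | 0 <= u < r ^+ 2] `<=` U, smooth U sigma,
        forall s : R, 0 <= s < r -> psi s = (sigma (s ^+ 2))%:E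
      & forall u : R, 0 <= u < r ^+ 2 -> 0 < derive1 sigma u] ;
  gp_Psimax_gt0 : (0 < Psimax)%E ;
  gp_Psimax : forall q,
    (forall i j, E i j -> enorm (q j - q i) <= r) ->
    (exists i j, E i j /\ enorm (q j - q i) = r) ->
    (Psimax <= Psi q)%E
}.

Definition in_range q : Prop := forall i j, E i j -> enorm (q j - q i) < r.

(* e_i; psi is finite and differentiable at the relevant points whenever the
   configuration is in range. *)
Definition coupling q (i : 'I_N) : 'cV[R]_n :=
  \sum_(j < N | E i j) grad (fun x => fine (psi (enorm (q j - x)))) (q i).

End Network.

Section ClosedLoop.
Context {R : realType} (N n : nat) (p : 'I_N -> nat).
Variables (E : rel 'I_N) (r : R) (psi : R -> \bar R).
Variables (M : 'I_N -> 'cV[R]_n -> 'M[R]_n)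
  (C : 'I_N -> 'cV[R]_n -> 'cV[R]_n -> 'M[R]_n)
  (g : 'I_N -> 'cV[R]_n -> 'cV[R]_n) (alpha : R)
  (Phi : forall i : 'I_N, 'cV[R]_n -> 'cV[R]_n -> 'cV[R]_n -> 'cV[R]_n ->
         'M[R]_(n, p i))
  (mu kappa : 'I_N -> R).

Definition time_interval (T : \bar R) : set R := [set t : R | 0 <= t /\ (t%:E < T)%E].

(* A solution on [0, T), 0 < T <= +oo: positions q, velocities v, estimates
   thetahat, inputs f.  The equations are required on the open interval ]0, T[
   and the state is continuous up to the initial time.  The control law involves
   psi, which does not exist beyond distance r, hence is prescribed only at
   those times at which the configuration is in range: that a solution stays in
   range is not part of the definition. *)
Record closed_loop_solution (T : \bar R) (q v : 'I_N -> R -> 'cV[R]_n)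
    (thetahat : forall i : 'I_N, R -> 'cV[R]_(p i)) (f : 'I_N -> R -> 'cV[R]_n)
    : Prop := {
  cl_T_gt0 : (0 < T)%E ;
  cl_continuous : forall i,
    [/\ {within time_interval T, continuous (q i)},
        {within time_interval T, continuous (v i)}
      & {within time_interval T, continuous (thetahat i)}] ;
  cl_plant : forall (i : 'I_N) (t : R), 0 < t -> (t%:E < T)%E ->
    [/\ is_derive t 1 (q i) (v i t), derivable (v i) t 1
      & M i (q i t) *m derive1 (v i) t + C i (q i t) (v i t) *m v i t + g i (q i t)
        = f i t] ;
  cl_control : forall (i : 'I_N) (t : R), 0 < t -> (t%:E < T)%E ->
    in_range E r (fun j => q j t) ->
    let e u := coupling E psi (fun j => q j u) i in
    let s := v i t + alpha *: e t in
    let Phi_t := Phi i (q i t) (v i t) (e t) (derive1 e t) in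
    f i t = Phi_t *m thetahat i t - mu i *: s - kappa i *: v i t /\
    is_derive t 1 (thetahat i) (- (Phi_t^T *m s))
}.

(* No finite escape: on a bounded interval the state stays in a compact subset
   of the domain of the closed-loop equations, so that a solution can only fail
   to exist for all t >= 0 through a lack of regularity of Phi. *)
Record connectivity_preserving_consensus (T : \bar R)
    (q v : 'I_N -> R -> 'cV[R]_n)
    (thetahat : forall i : 'I_N, R -> 'cV[R]_(p i)) : Prop := {
  cpc_connectivity : forall t : R, 0 <= t -> (t%:E < T)%E ->
    forall i j, E i j -> enorm (q i t - q j t) < r ;
  cpc_consensus : T = +oo%E ->
    forall i j, q i t - q j t @[t --> +oo] --> (0 : 'cV[R]_n) ;
  cpc_no_finite_escape : (T < +oo)%E ->
    exists B delta : R, 0 < delta /\ forall t : R, 0 <= t -> (t%:E < T)%E ->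
      (forall i, [/\ enorm (q i t) <= B, enorm (v i t) <= B
                   & enorm (thetahat i t) <= B]) /\
      (forall i j, E i j -> enorm (q i t - q j t) <= r - delta)
}.

Definition achieves_consensus (q0 v0 : 'I_N -> 'cV[R]_n)
    (thetahat0 : forall i : 'I_N, 'cV[R]_(p i)) : Prop :=
  forall (T : \bar R) (q v : 'I_N -> R -> 'cV[R]_n)
    (thetahat : forall i : 'I_N, R -> 'cV[R]_(p i)) (f : 'I_N -> R -> 'cV[R]_n),
  closed_loop_solution T q v thetahat f ->
  (forall i, [/\ q i 0 = q0 i, v i 0 = v0 i & thetahat i 0 = thetahat0 i]) ->
  connectivity_preserving_consensus T q v thetahat.

End ClosedLoop.

(* Main.v *)
Require Import Defs.
From HB Require Import structures.
From mathcomp Require Import all_boot all_order all_algebra.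
From mathcomp Require Import all_classical all_reals all_analysis.
From mathcomp Require Import ring lra.
Import Order.TTheory GRing.Theory Num.Theory.
Import numFieldNormedType.Exports.
Local Open Scope classical_set_scope.
Local Open Scope ring_scope.

(** Why the theorem holds.  Inside the communication range, [psi s = sigma (s^2)] with
    [rho = sigma' > 0], so the coupling is the graph Laplacian type force
    [e_i = \sum_j 2 rho(|q_j - q_i|^2) (q_i - q_j)] ([coupling_in_range]).  Put
    [s_i = v_i + alpha e_i] and
      [L = alpha Psi(q) + \sum_i (s_i^T M_i s_i + |theta_i - thetahat_i|^2) / (2 kappa_i)].
    By the regressor identity, the skew-symmetry of [M' - 2 C] and the adaptation law,
      [L' = - \sum_i (mu_i / kappa_i) |s_i|^2 - \sum_i |v_i|^2]
    ([agent_balance], [is_derive_lyapunov]).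

    Connectivity: as long as the configuration is in range, [alpha Psi <= L <= L(0)].
    If [L(0) / alpha < Psimax], a limit of such configurations has potential below
    [Psimax], hence no link of length [r] ([limit_in_range]); so the configuration
    never leaves the range ([always_in_range]), and by compactness the link lengths
    even stay at a positive distance from [r] ([uniform_gap]).  The condition on
    [L(0)] is void when [Psimax = +oo], and holds for large [kappa_i] otherwise
    ([lyapunov_high_gain]).

    Consensus: the gap bounds [rho] above and away from 0, and makes the velocities
    bounded.  The sum [y] of the squared link lengths is then Lipschitz in time, and
    [y >= e] forces [L' <= - c] for some [c > 0] depending on [e]
    ([dissipation_spread]).  As [L] is bounded below, [y] tends to 0
    ([lyapunov_decay_cvg0]), and connectedness of the graph spreads this to all pairs.
    Only [v] and [s] have to be controlled: a bound on the acceleration would require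
    one on the regressor matrices, which enter only through [Phi_i theta_i] and through
    terms that cancel. *)

Set Implicit Arguments.
Unset Strict Implicit.
Unset Printing Implicit Defensive.

(** * Euclidean inner product on column vectors *)

Section Dot.
Context {R : realType}.

(** The Euclidean inner product, as a matrix product: [enorm x ^+ 2 = dot x x]. *)
Definition dot m (x y : 'cV[R]_m) : R := (x^T *m y) 0 0.

Lemma dotE m (x y : 'cV[R]_m) : dot x y = \sum_k x k 0 * y k 0.
Proof. by rewrite /dot mxE; apply: eq_bigr => k _; rewrite mxE. Qed.

Lemma dotC m (x y : 'cV[R]_m) : dot x y = dot y x.
Proof. by rewrite !dotE; apply: eq_bigr => k _; rewrite mulrC. Qed.

Lemma dotDl m (x y z : 'cV[R]_m) : dot (x + y) z = dot x z + dot y z.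
Proof. by rewrite /dot linearD mulmxDl mxE. Qed.

Lemma dotDr m (x y z : 'cV[R]_m) : dot z (x + y) = dot z x + dot z y.
Proof. by rewrite /dot mulmxDr mxE. Qed.

Lemma dotZl m a (x y : 'cV[R]_m) : dot (a *: x) y = a * dot x y.
Proof. by rewrite /dot linearZ -scalemxAl mxE. Qed.

Lemma dotZr m a (x y : 'cV[R]_m) : dot y (a *: x) = a * dot y x.
Proof. by rewrite dotC dotZl dotC. Qed.

Lemma dotNl m (x y : 'cV[R]_m) : dot (- x) y = - dot x y.
Proof. by rewrite -scaleN1r dotZl mulN1r. Qed.

Lemma dotNr m (x y : 'cV[R]_m) : dot y (- x) = - dot y x.
Proof. by rewrite dotC dotNl dotC. Qed.

Lemma dotBl m (x y z : 'cV[R]_m) : dot (x - y) z = dot x z - dot y z.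
Proof. by rewrite dotDl dotNl. Qed.

Lemma dotBr m (x y z : 'cV[R]_m) : dot z (x - y) = dot z x - dot z y.
Proof. by rewrite dotDr dotNr. Qed.

Lemma dot0l m (x : 'cV[R]_m) : dot 0 x = 0.
Proof. by rewrite -(scale0r 0) dotZl mul0r. Qed.

Lemma dot_suml m I (s : seq I) (P : pred I) (F : I -> 'cV[R]_m) x :
  dot (\sum_(i <- s | P i) F i) x = \sum_(i <- s | P i) dot (F i) x.
Proof.
by elim/big_rec2: _ => [|i a b _ <-]; rewrite ?dot0l// dotDl.
Qed.

Lemma dot_trmx m p (A : 'M[R]_(m, p)) (x : 'cV[R]_m) (y : 'cV[R]_p) :
  dot x (A *m y) = dot (A^T *m x) y.
Proof. by rewrite /dot trmx_mul trmxK mulmxA. Qed.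

Lemma dot_delta m (x : 'cV[R]_m) k : dot x (delta_mx k 0) = x k 0.
Proof.
rewrite dotE (bigD1 k)//= mxE !eqxx mulr1 big1 ?addr0// => l lk.
by rewrite mxE (negbTE lk) mulr0.
Qed.

Lemma dotxx_ge0 m (x : 'cV[R]_m) : 0 <= dot x x.
Proof. by rewrite dotE; apply: sumr_ge0 => k _; rewrite -expr2 sqr_ge0. Qed.

Lemma enorm_sq m (x : 'cV[R]_m) : enorm x ^+ 2 = dot x x.
Proof.
rewrite /enorm sqr_sqrtr ?dotE; last first.
  by apply: sumr_ge0 => k _; rewrite sqr_ge0.
by apply: eq_bigr => k _; rewrite expr2.
Qed.

Lemma enorm_sqrt m (x : 'cV[R]_m) : enorm x = Num.sqrt (dot x x).
Proof. by rewrite dotE; congr Num.sqrt; apply: eq_bigr => k _; rewrite expr2. Qed.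

Lemma enorm_ge0 m (x : 'cV[R]_m) : 0 <= enorm x.
Proof. exact: sqrtr_ge0. Qed.

Lemma enormN m (x : 'cV[R]_m) : enorm (- x) = enorm x.
Proof. by rewrite !enorm_sqrt dotNl dotNr opprK. Qed.

Lemma enormB m (x y : 'cV[R]_m) : enorm (x - y) = enorm (y - x).
Proof. by rewrite -enormN opprB. Qed.

Lemma sqr_coord_le m (x : 'cV[R]_m) k : x k 0 ^+ 2 <= dot x x.
Proof.
rewrite dotE (bigD1 k)//= -expr2 lerDl; apply: sumr_ge0 => l _.
by rewrite -expr2 sqr_ge0.
Qed.

Lemma coord_le_enorm m (x : 'cV[R]_m) k : `|x k 0| <= enorm x.
Proof. by rewrite enorm_sqrt -sqrtr_sqr ler_wsqrtr// sqr_coord_le. Qed.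

Lemma enorm_le m (x : 'cV[R]_m) b : 0 <= b -> (enorm x <= b) = (dot x x <= b ^+ 2).
Proof. by move=> b0; rewrite -enorm_sq ler_sqr// nnegrE enorm_ge0. Qed.

Lemma enorm_lt m (x : 'cV[R]_m) b : 0 <= b -> (enorm x < b) = (dot x x < b ^+ 2).
Proof. by move=> b0; rewrite -enorm_sq ltr_sqr// nnegrE enorm_ge0. Qed.

Lemma dot_lt_sqr m (x : 'cV[R]_m) b : 0 < b -> enorm x < b -> 0 <= dot x x < b ^+ 2.
Proof. by move=> b0; rewrite (enorm_lt _ (ltW b0)) dotxx_ge0 => ->. Qed.

Lemma dot_le_coord m (x : 'cV[R]_m) (b : R) :
  (forall k, `|x k 0| <= b) -> dot x x <= m%:R * b ^+ 2.
Proof.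
move=> xb; rewrite dotE.
apply: (@le_trans _ _ (\sum_(k < m) b ^+ 2)); last first.
  by rewrite sumr_const card_ord mulr_natl.
apply: ler_sum => k _; rewrite -expr2 -real_normK ?num_real//.
by rewrite ler_sqr ?nnegrE// (le_trans _ (xb k)).
Qed.

Lemma dot_sqrB_le m (x y : 'cV[R]_m) :
  dot (x - y) (x - y) <= 2 * (dot x x + dot y y).
Proof.
have := dotxx_ge0 (x + y).
rewrite !dotDl !dotDr !dotNl !dotNr (dotC y x); lra.
Qed.

(** The weighted form is what lets the coupling term be absorbed in
    [dissipation_spread]. *)
Lemma dot_young m (x y : 'cV[R]_m) (c : R) : 0 < c ->
  2 * dot x y <= c * dot x x + c^-1 * dot y y.
Proof.
move=> c0; have := dotxx_ge0 (c *: x - y).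
rewrite dotBl !dotBr !dotZl !dotZr (dotC y x).
rewrite -(@pmulr_rge0 _ c^-1) ?invr_gt0// => h.
rewrite -subr_ge0; apply: le_trans h _; rewrite le_eqVlt; apply/orP; left.
by apply/eqP; field; rewrite gt_eqF.
Qed.

End Dot.

(** * Derivatives and limits of matrix-valued functions *)

Section MatrixAnalysis.
Context {R : realType}.

Lemma is_derive_mxP (V : normedModType R) m p (M : V -> 'M[R]_(m, p)) t v dM :
  is_derive t v M dM <-> forall i j, is_derive t v (fun x => M x i j) (dM i j).
Proof.
split=> [[Md <-] i j|H].
  by rewrite derive_mx// mxE; apply: derivableP; apply: (derivable_mxP _ _ _).1.
have Md : derivable M t v by apply/derivable_mxP => i j; case: (H i j).
apply: DeriveDef => //; rewrite derive_mx//; apply/matrixP => i j; rewrite mxE.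
by apply: derive_val.
Qed.

Lemma is_derive_fsum (V : normedModType R) (W : normedModType R) n (P : pred 'I_n)
    (h : 'I_n -> V -> W) (dh : 'I_n -> W) x v :
  (forall i, P i -> is_derive x v (h i) (dh i)) ->
  is_derive x v (fun y => \sum_(i | P i) h i y) (\sum_(i | P i) dh i).
Proof.
move=> H.
rewrite (_ : (fun y => _) = \sum_(i < n) (if P i then h i else cst 0)); last first.
  apply/funext => y; rewrite fct_sumE big_mkcond; apply: eq_bigr => i _.
  by case: (P i).
rewrite [X in is_derive _ _ _ X]big_mkcond.
by apply: is_derive_sum => i; case: ifPn => [/H//|_]; exact: is_derive_cst.
Qed.

Lemma is_derive_fM (V : normedModType R) (f g : V -> R) df dg x v :
  is_derive x v f df -> is_derive x v g dg ->
  is_derive x v (fun y => f y * g y) (df * g x + f x * dg).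
Proof.
move=> hf hg; apply: (is_derive_eq (is_deriveM hf hg)).
by rewrite addrC [_ *: df]mulrC.
Qed.

Lemma is_derive_fD (V : normedModType R) (W : normedModType R) (f g : V -> W) df dg x v :
  is_derive x v f df -> is_derive x v g dg ->
  is_derive x v (fun y => f y + g y) (df + dg).
Proof. by move=> hf hg; apply: is_deriveD. Qed.

Lemma is_derive_fB (V : normedModType R) (W : normedModType R) (f g : V -> W) df dg x v :
  is_derive x v f df -> is_derive x v g dg ->
  is_derive x v (fun y => f y - g y) (df - dg).
Proof. by move=> hf hg; apply: is_deriveB. Qed.

Lemma is_derive_fZ (V : normedModType R) (W : normedModType R) a (f : V -> W) df x v :
  is_derive x v f df -> is_derive x v (fun y => a *: f y) (a *: df).
Proof. by move=> hf; apply: is_deriveZ. Qed.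

Lemma is_derive_fMl (V : normedModType R) (k : R) (f : V -> R) df x v :
  is_derive x v f df -> is_derive x v (fun y => k * f y) (k * df).
Proof. by move=> hf; exact: (is_deriveZ k). Qed.

Lemma is_derive_mulmx (V : normedModType R) m p k (A : V -> 'M[R]_(m, p))
    (B : V -> 'M[R]_(p, k)) dA dB x v :
  is_derive x v A dA -> is_derive x v B dB ->
  is_derive x v (fun y => A y *m B y) (dA *m B x + A x *m dB).
Proof.
move=> /is_derive_mxP hA /is_derive_mxP hB; apply/is_derive_mxP => i j.
rewrite mxE !mxE -big_split/=.
under eq_fun do rewrite mxE.
by apply: is_derive_fsum => l _; apply: is_derive_fM.
Qed.

Lemma is_derive_dot (V : normedModType R) m (f g : V -> 'cV[R]_m) df dg x v :
  is_derive x v f df -> is_derive x v g dg ->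
  is_derive x v (fun y => dot (f y) (g y)) (dot df (g x) + dot (f x) dg).
Proof.
move=> /is_derive_mxP hf /is_derive_mxP hg.
rewrite !dotE -big_split/=; under eq_fun do rewrite dotE.
by apply: is_derive_fsum => l _; apply: is_derive_fM.
Qed.

Lemma is_derive_scalemx (V : normedModType R) m p (a : V -> R) (B : V -> 'M[R]_(m, p))
    da dB x v :
  is_derive x v a da -> is_derive x v B dB ->
  is_derive x v (fun y => a y *: B y) (da *: B x + a x *: dB).
Proof.
move=> ha /is_derive_mxP hB; apply/is_derive_mxP => i j.
by rewrite !mxE; under eq_fun do rewrite mxE; apply: is_derive_fM.
Qed.

(** Chain rule along a curve [q]; for [f] the inertia matrix this is the time
    derivative of [M (q t)] as it occurs in the skew-symmetry property. *)
Lemma is_derive_comp_mx (V W : normedModType R) (f : V -> W) (q : R -> V) t dq :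
  differentiable f (q t) -> is_derive t 1 q dq ->
  is_derive t 1 (fun u => f (q u)) ('D_dq f (q t)).
Proof.
move=> fd [qd qE].
have qdiff : differentiable q t by apply/derivable1_diffP.
have cd : differentiable (f \o q) t by apply: differentiable_comp.
rewrite deriveE// -qE deriveE//.
apply: DeriveDef; first exact: diff_derivable.
by rewrite (deriveE _ cd) diff_comp.
Qed.

Lemma cvg_mxP T m p (F : set_system T) {FF : Filter F} (M : T -> 'M[R]_(m, p)) (L : 'M[R]_(m, p)) :
  M x @[x --> F] --> L <-> forall i j, M x i j @[x --> F] --> L i j.
Proof.
split=> [ML i j|H].
  apply: (@cvg_comp _ _ _ M (fun N : 'M[R]_(m, p) => N i j) _ _ _ ML).
  exact: coord_continuous.
move=> A [P LP PA]; rewrite /fmap/= nbhs_simpl/=.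
have : \forall x \near F, forall ij : 'I_m * 'I_p, P ij.1 ij.2 (M x ij.1 ij.2).
  by apply: filter_forall => ij; apply: H; apply: LP.
by apply: filterS => x Hx; apply: PA => i j; apply: (Hx (i, j)).
Qed.

Lemma cvg_fsum (V : normedModType R) T n (P : pred 'I_n) (F : set_system T) {FF : Filter F}
    (h : 'I_n -> T -> V) (l : 'I_n -> V) :
  (forall i, P i -> h i x @[x --> F] --> l i) ->
  (\sum_(i | P i) h i x) @[x --> F] --> \sum_(i | P i) l i.
Proof.
move=> H; elim: (index_enum _) => [|i s IHs]; rewrite ?big_nil ?big_cons.
  by under eq_fun do rewrite big_nil; exact: cvg_cst.
under eq_fun do rewrite big_cons.
by case: ifPn => [Pi|//]; apply: cvgD IHs; exact: H.
Qed.

Lemma cvg_mulmx T m p k (F : set_system T) {FF : Filter F} (A : T -> 'M[R]_(m, p))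
    (B : T -> 'M[R]_(p, k)) (a : 'M[R]_(m, p)) (b : 'M[R]_(p, k)) :
  A x @[x --> F] --> a -> B x @[x --> F] --> b -> A x *m B x @[x --> F] --> a *m b.
Proof.
move=> /cvg_mxP hA /cvg_mxP hB; apply/cvg_mxP => i j; rewrite mxE.
under eq_fun do rewrite mxE.
by apply: cvg_fsum => l _; apply: cvgM.
Qed.

Lemma cvg_dot T m (F : set_system T) {FF : Filter F} (f g : T -> 'cV[R]_m) (a b : 'cV[R]_m) :
  f x @[x --> F] --> a -> g x @[x --> F] --> b -> dot (f x) (g x) @[x --> F] --> dot a b.
Proof.
move=> /cvg_mxP hA /cvg_mxP hB; rewrite dotE; under eq_fun do rewrite dotE.
by apply: cvg_fsum => l _; apply: cvgM.
Qed.

Lemma cvg_enorm T m (F : set_system T) {FF : Filter F} (f : T -> 'cV[R]_m) (a : 'cV[R]_m) :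
  f x @[x --> F] --> a -> enorm (f x) @[x --> F] --> enorm a.
Proof.
move=> fa; rewrite enorm_sqrt; under eq_fun do rewrite enorm_sqrt.
apply: continuous_cvg; [exact: sqrt_continuous|exact: cvg_dot].
Qed.

Lemma cvg_comp_derivable T (F : set_system T) {FF : Filter F} (f : R -> R)
    (h : T -> R) l :
  derivable f l 1 -> h x @[x --> F] --> l -> f (h x) @[x --> F] --> f l.
Proof.
move=> /derivable1_diffP/differentiable_continuous fc hl.
exact: continuous_cvg.
Qed.

End MatrixAnalysis.

Section ScalarChain.
Context {R : realType} (V : normedModType R).

Lemma is_derive_lineP (f : V -> R) (x v : V) (df : R) :
  is_derive x v f df <-> is_derive (0 : R) 1 (fun h => f (h *: v + x)) df.
Proof.
have E : (fun h : R => h^-1 *: (f ((h *: (1 : R^o) + 0 : R) *: v + x) - f ((0 : R) *: v + x))) =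
         (fun h : R => h^-1 *: (f (h *: v + x) - f x)).
  by apply/funext => h; rewrite addr0 [_ *: 1]mulr1 scale0r add0r.
split=> [[fd fE]|[fd fE]]; apply: DeriveDef.
- by rewrite /derivable /= E.
- by rewrite /derive /= E.
- by move: fd; rewrite /derivable /= E.
- by move: fE; rewrite /derive /= E.
Qed.

Lemma is_derive_comp_scalar (f : R -> R) (g : V -> R) x v (a b : R) :
  is_derive (g x) 1 f a -> is_derive x v g b ->
  is_derive x v (fun y => f (g y)) (a * b).
Proof.
move=> hf /is_derive_lineP hg; apply/is_derive_lineP.
by apply: is_derive1_comp => //; rewrite scale0r add0r.
Qed.

End ScalarChain.

(** * Decay along a Lyapunov function *)

Section Decay.
Context {R : realType}.

Lemma derive1_le0_nincr (W : R -> R) (a b : R) : a <= b ->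
  (forall t : R, a <= t <= b -> derivable W t 1) ->
  (forall t : R, a <= t <= b -> derive1 W t <= 0) -> W b <= W a.
Proof.
move=> ab dW W0.
have [t tab E] : exists2 t, t \in `[a, b]%R & W b - W a = derive1 W t * (b - a).
  apply: MVT_segment => // [t|].
    rewrite in_itv/= => /andP[ta tb]; rewrite derive1E; apply: derivableP.
    by apply: dW; rewrite !ltW.
  by apply: derivable_within_continuous => t; rewrite in_itv/=; exact: dW.
by rewrite -subr_le0 E mulr_le0_ge0 ?subr_ge0// W0// -in_itv.
Qed.

(** An integral-free form of Barbalat's lemma.  If [y] does not tend to 0, then
    it exceeds some [e] at arbitrarily late times; being Lipschitz it stays above
    [e / 2] for a fixed duration [d], during which [W] loses a fixed amount
    [c * d].  This is impossible once [W] is within [c * d] of its infimum. *)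
Lemma lyapunov_decay_cvg0 (W y : R -> R) (L : R) : 0 < L ->
  (forall t : R, 0 < t -> derivable W t 1) ->
  (forall t : R, 0 < t -> 0 <= W t) ->
  (forall t : R, 0 < t -> derive1 W t <= 0) ->
  (forall t : R, 0 < t -> 0 <= y t) ->
  (forall s t : R, 0 < s -> s <= t -> y s - y t <= L * (t - s)) ->
  (forall e : R, 0 < e -> exists2 c, 0 < c &
     forall t : R, 0 < t -> e <= y t -> derive1 W t <= - c) ->
  y t @[t --> +oo] --> 0.
Proof.
move=> L0 dW W0 dW0 y0 yL dWy.
apply/cvgrPdist_lt => /= e e0.
have [c c0 yc] := dWy (e / 2) ltac:(lra).
pose d := e / (2 * L).
have d0 : 0 < d by rewrite divr_gt0// mulr_gt0.
pose S := [set W t | t in [set t | 0 < t]].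
have infS : has_inf S.
  split; first by exists (W 1), 1 => //=.
  by exists 0 => _ [t /= t0 <-]; exact: W0.
have [_ [t0 /= t00 <-] Wt0] := inf_adherent (mulr_gt0 c0 d0) infS.
near=> t.
have t0t : t0 <= t by near: t; apply: nbhs_pinfty_ge; exact: num_real.
have tgt0 : 0 < t by apply: lt_le_trans t0t.
rewrite sub0r normrN ger0_norm ?y0// ltNge; apply/negP => ety.
have Wt : W t <= W t0.
  apply: derive1_le0_nincr => // u /andP[t0u _].
    by apply: dW; apply: lt_le_trans t0u.
  by apply: dW0; apply: lt_le_trans t0u.
have td : t <= t + d by rewrite lerDl ltW.
have [u] : exists2 u, u \in `[t, (t + d)]%R & W (t + d) - W t = derive1 W u * (t + d - t).
  apply: MVT_segment => // [u|].
    rewrite in_itv/= => /andP[tu _]; rewrite derive1E; apply: derivableP.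
    by apply: dW; apply: lt_trans tu.
  apply: derivable_within_continuous => u; rewrite in_itv/= => /andP[tu _].
  by apply: dW; apply: lt_le_trans tu.
rewrite in_itv/= => /andP[tu utd] E.
have yu : e / 2 <= y u.
  have := yL _ _ tgt0 tu.
  have : L * (u - t) <= L * d by rewrite ler_pM2l// lerBlDl.
  have -> : L * d = e / 2 by rewrite /d; field; rewrite gt_eqF.
  lra.
have Wu := yc _ (lt_le_trans tgt0 tu) yu.
have : inf S <= W (t + d).
  by apply: ge_inf; [case: infS|exists (t + d) => //=; rewrite addr_gt0].
have : derive1 W u * d <= - c * d by rewrite ler_pM2r.
move: E; rewrite (_ : t + d - t = d); [lra|ring].
Unshelve. all: by end_near. Qed.

End Decay.

(** * The potential and the coupling inside the communication range *)

Section Profile.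
Context {R : realType}.

(** The regularity of the pair potential: on [[0, r)], [psi s = sigma (s ^+ 2)]
    with [sigma] twice differentiable at the squares of in-range distances and
    with positive slope [rho = sigma']. *)
Record potential_profile (r : R) (psi : R -> \bar R) (sigma rho : R -> R) : Prop := {
  profileE : forall s, 0 <= s < r -> psi s = (sigma (s ^+ 2))%:E ;
  profile_derive : forall u, 0 <= u < r ^+ 2 -> is_derive u 1 sigma (rho u) ;
  profile_slope_derivable : forall u, 0 <= u < r ^+ 2 -> derivable rho u 1 ;
  profile_slope_gt0 : forall u, 0 <= u < r ^+ 2 -> 0 < rho u
}.

Lemma generalized_potential_profile N n (E : rel 'I_N) r (psi : R -> \bar R) Psimax :
  generalized_potential n E r psi Psimax ->
  exists sigma, potential_profile r psi sigma (derive1 sigma).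
Proof.
move=> gp; have [U [sigma [Uo rU sU psiE pos]]] := gp_smooth gp.
exists sigma; split=> //.
- move=> u /rU Uu; rewrite derive1E; apply: derivableP; apply/derivable1_diffP.
  by have [+ _] := sU 1%N; apply.
- move=> u /rU Uu; apply/derivable1_diffP.
  have [_ /(_ 1) [+ _]] := sU 2%N => /(_ u Uu).
  by rewrite (_ : (fun x => _) = derive1 sigma)//; apply/funext => x; rewrite derive1E.
Qed.

Context (N n : nat) (E : rel 'I_N) (r : R) (psi : R -> \bar R) (sigma rho : R -> R).
Context (r0 : 0 < r) (prof : potential_profile r psi sigma rho).
Implicit Types q : 'I_N -> 'cV[R]_n.

Lemma psi_enorm (x : 'cV[R]_n) : enorm x < r -> psi (enorm x) = (sigma (dot x x))%:E.
Proof. by move=> xr; rewrite (profileE prof) ?enorm_ge0// enorm_sq. Qed.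

Lemma grad_psi (x y : 'cV[R]_n) : enorm (y - x) < r ->
  grad (fun z => fine (psi (enorm (y - z)))) x =
  (2 * rho (dot (y - x) (y - x))) *: (x - y).
Proof.
move=> yxr; apply/matrixP => k j; rewrite ord1 !mxE.
have -> : 'D_(delta_mx k 0) (fun z => fine (psi (enorm (y - z)))) x =
    'D_(delta_mx k 0) (fun z => sigma (dot (y - z) (y - z))) x.
  apply: near_eq_derive; near=> z; rewrite psi_enorm//; near: z.
  have yz : y - z @[z --> x] --> y - x.
    by apply: (@cvgB R 'cV[R]_n _ (nbhs x) _ (fun=> y) id); [exact: cvg_cst|exact: cvg_id].
  exact: (cvgr_lt _ (cvg_enorm yz) _ yxr).
have hB : is_derive x (delta_mx k 0) (fun z => y - z) (0 - delta_mx k 0).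
  exact: is_derive_fB.
have hd := is_derive_dot hB hB.
have := is_derive_comp_scalar (g := fun z => dot (y - z) (y - z))
  (profile_derive prof (dot_lt_sqr r0 yxr)) hd.
move=> [_ ->]; rewrite sub0r dotNl dotNr (dotC (delta_mx _ _)) dot_delta !mxE; ring.
Unshelve. all: by end_near. Qed.

(** The coupling [e_i] in closed form: a weighted sum of relative positions, with
    symmetric positive weights [2 * rho (|q_j - q_i|^2)]. *)
Definition coupling_force q i : 'cV[R]_n :=
  \sum_(j < N | E i j) (2 * rho (dot (q j - q i) (q j - q i))) *: (q i - q j).

Lemma coupling_in_range q i : in_range E r q -> coupling E psi q i = coupling_force q i.
Proof. by move=> qr; apply: eq_bigr => j Eij; rewrite grad_psi// qr. Qed.

(** The real-valued potential energy, equal to [Psi] on in-range configurations. *)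
Definition energy q : R :=
  2^-1 * \sum_(i < N) \sum_(j < N | E i j) sigma (dot (q j - q i) (q j - q i)).

Lemma Psi_in_range q : in_range E r q -> Psi E psi q = (energy q)%:E.
Proof.
move=> qr; rewrite /Psi /energy EFinM; congr (_ * _)%E.
rewrite -sumEFin; apply: eq_bigr => i _; rewrite -sumEFin; apply: eq_bigr => j Eij.
by rewrite psi_enorm// qr.
Qed.

End Profile.

Section Closure.
Context {R : realType} (N n : nat) (E : rel 'I_N) (r : R) (psi : R -> \bar R)
  (Psimax : \bar R).
Context (gp : generalized_potential n E r psi Psimax).
Implicit Types q : 'I_N -> 'cV[R]_n.

Lemma Psi_ge0 q : in_range E r q -> (0 <= Psi E psi q)%E.
Proof.
move=> qr; apply: mule_ge0; first by rewrite lee_fin.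
apply: sume_ge0 => i _; apply: sume_ge0 => j Eij; apply: (gp_ge0 gp).
by rewrite enorm_ge0 ltW// qr.
Qed.

Lemma cvg_psi T (F : set_system T) {FF : ProperFilter F} (s : T -> R) (l : R) :
  s x @[x --> F] --> l -> (\forall x \near F, 0 <= s x <= r) ->
  psi (s x) @[x --> F] --> psi l.
Proof.
move=> sl sr.
have lr : 0 <= l <= r.
  apply/andP; split.
    by apply: (cvgr_to_ge sl); apply: filterS sr => x /andP[].
  by apply: (cvgr_to_le sl); apply: filterS sr => x /andP[].
have /subspace_continuousP/(_ l lr) psil := gp_continuous gp.
apply: (@cvg_comp _ _ _ s psi _ _ _ _ psil) => A hA.
have sA : \forall x \near F, 0 <= s x <= r -> A (s x) := sl _ hA.
suff : \forall x \near F, A (s x) by [].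
by apply: filterS2 sA sr => x /= + sxr; apply.
Qed.

(** In-range configurations whose potential stays below a level [c < Psimax] cannot
    converge to a configuration at which some link has length [r]: by continuity of
    [psi] the limit would still have potential at most [c].  The possible value
    [+oo] of [psi r] is why the limit is taken in the extended reals. *)
Lemma limit_in_range T (F : set_system T) {FF : ProperFilter F}
    (qx : T -> 'I_N -> 'cV[R]_n) q (c : R) : (c%:E < Psimax)%E ->
  (forall i j, E i j -> enorm (qx x j - qx x i) @[x --> F] --> enorm (q j - q i)) ->
  (\forall x \near F, in_range E r (qx x) /\ (Psi E psi (qx x) <= c%:E)%E) ->
  in_range E r q.
Proof.
move=> cP qxq Fr.
have sr i j : E i j -> \forall x \near F, 0 <= enorm (qx x j - qx x i) <= r.
  by move=> Eij; apply: filterS Fr => x [+ _] => /(_ _ _ Eij)/ltW ->; rewrite enorm_ge0.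
have qr i j : E i j -> enorm (q j - q i) <= r.
  move=> Eij; apply: (cvgr_to_le (qxq _ _ Eij)).
  by apply: filterS (sr _ _ Eij) => x /andP[].
have Psic : (Psi E psi q <= c%:E)%E.
  have PsiF : \forall x \near F, (c%:E >= Psi E psi (qx x))%E by apply: filterS Fr => x [].
  suff : Psi E psi (qx x) @[x --> F] --> Psi E psi q by move/(cvge_le PsiF).
  apply: cvgeZl => //; apply: cvg_nnesum => [i _|i _].
    apply: filterS Fr => x [xr _]; apply: sume_ge0 => j Eij; apply: (gp_ge0 gp).
    by rewrite enorm_ge0 ltW// xr.
  apply: cvg_nnesum => [j Eij|j Eij].
    by apply: filterS (sr _ _ Eij) => x; exact: (gp_ge0 gp).
  exact: cvg_psi (qxq _ _ Eij) (sr _ _ Eij).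
move=> i j Eij; rewrite lt_neqAle qr// andbT; apply/eqP => qE.
have := gp_Psimax gp qr (ex_intro _ i (ex_intro _ j (conj Eij qE))).
by rewrite leNgt (le_lt_trans Psic).
Qed.

End Closure.

(** * Compactness and connected configurations *)

Section Compactness.
Context {R : realType}.

Lemma ultra_cvg_bounded T (F : set_system T) {FU : UltraFilter F} (f : T -> R) (b : R) :
  (\forall x \near F, `|f x| <= b) -> exists l : R, f x @[x --> F] --> l.
Proof.
move=> fb.
have Fb : (f @ F) `[(- b), b]%classic.
  by apply: filterS fb => x; rewrite /= in_itv/= ler_norml.
have [l [_ cl]] := segment_compact _ Fb.
exists l => B Bl; have [//|FnB] := in_ultra_setVsetC (f @^-1` B) FU.
by have [y [nBy By]] := cl (~` B) B FnB Bl.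
Qed.

Lemma ultra_cvg_mx T (F : set_system T) {FU : UltraFilter F} m k (f : T -> 'M[R]_(m, k))
    (b : R) :
  (forall i j, \forall x \near F, `|f x i j| <= b) -> exists l : 'M[R]_(m, k), f x @[x --> F] --> l.
Proof.
move=> fb.
have H i j : exists l, f x i j @[x --> F] --> (l : R) by exact: ultra_cvg_bounded (fb i j).
exists (\matrix_(i, j) sval (cid (H i j))); apply/cvg_mxP => i j.
by rewrite mxE; exact: (svalP (cid (H i j))).
Qed.

Lemma path_coord_le N n (E : rel 'I_N) (r : R) (q : 'I_N -> 'cV[R]_n) i s k :
  in_range E r q -> path E i s -> `|(q (last i s) - q i) k 0| <= (size s)%:R * r.
Proof.
move=> qr; elim: s i => [|j s IHs] i /=.
  by rewrite subrr mxE normr0 mul0r.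
move=> /andP[Eij /IHs h].
have -> : q (last j s) - q i = (q (last j s) - q j) + (q j - q i) by rewrite addrA subrK.
rewrite mxE (le_trans (ler_normD _ _))// -natr1 mulrDl mul1r lerD//.
by rewrite (le_trans (coord_le_enorm _ _))// ltW// qr.
Qed.

(** Relative positions are bounded because a repetition-free path between two
    agents has fewer than [N] links, each shorter than [r]. *)
Lemma connected_coord_le N n (E : rel 'I_N) (r : R) (q : 'I_N -> 'cV[R]_n) i j k :
  0 <= r -> (forall i j, connect E i j) -> in_range E r q ->
  `|(q j - q i) k 0| <= N%:R * r.
Proof.
move=> r0 conn qr; have /connectP[s Es ->] := conn i j.
case: (shortenP Es) => s' Es' us' _.
rewrite (le_trans (path_coord_le _ qr Es'))// ler_wpM2r// ler_nat.
by have := max_card (mem (i :: s')); rewrite (card_uniqP us') card_ord; exact: ltnW.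
Qed.

Lemma connected_cvg0 N n (E : rel 'I_N) T (F : set_system T) {FF : Filter F}
    (q : T -> 'I_N -> 'cV[R]_n) :
  (forall i j, connect E i j) ->
  (forall i j, E i j -> q x j - q x i @[x --> F] --> (0 : 'cV[R]_n)) ->
  forall i j, q x j - q x i @[x --> F] --> (0 : 'cV[R]_n).
Proof.
move=> conn edge i j; have /connectP[s + ->] := conn i j.
elim: s i => [|k s IHs] i /=.
  by move=> _; under eq_fun do rewrite subrr; exact: cvg_cst.
move=> /andP[Eik /IHs h].
have -> : (fun x => q x (last k s) - q x i) =
    (fun x => (q x (last k s) - q x k) + (q x k - q x i)).
  by apply/funext => x; rewrite addrA subrK.
rewrite -[X in _ --> X](addr0 (0 : 'cV[R]_n)); apply: cvgD; [exact: h|exact: edge].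
Qed.

End Compactness.

Section FiniteBound.
Context {R : realType}.

(** Bounds that depend on the agent can be made uniform. *)
Lemma finite_upper_bound (I : finType) T (P : T -> Prop) (f : I -> T -> R) :
  (forall i, exists b, forall t, P t -> f i t <= b) ->
  exists2 b, 0 <= b & forall i t, P t -> f i t <= b.
Proof.
move=> fb.
have H : \forall b \near +oo, forall i, forall t, P t -> f i t <= b.
  apply: filter_forall => i; have [bi Hbi] := fb i.
  near=> b => t Pt; apply: le_trans (Hbi _ Pt) _.
  by near: b; apply: nbhs_pinfty_ge; exact: num_real.
have [b [b0 Hb]] : exists b : R, 0 <= b /\ forall i t, P t -> f i t <= b.
  apply: (@filter_ex _ (+oo : set_system R)); apply: filterI => //.
  by apply: nbhs_pinfty_ge; exact: num_real.
by exists b.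
Unshelve. all: by end_near. Qed.

End FiniteBound.

(** * The Lyapunov function *)

Section AgentBalance.
Context {R : realType} (n p : nat).

Lemma dot_skew (A : 'M[R]_n) (x : 'cV[R]_n) : skew_symmetric A -> dot x (A *m x) = 0.
Proof.
move=> Ask; have : dot x (A *m x) = - dot x (A *m x); last by lra.
by rewrite {1}dot_trmx Ask mulNmx dotNl dotC.
Qed.

(** The energy balance of one agent.  The two lines of the left-hand side are the
    derivatives of [s^T M s] and of [|th - thhat|^2]: the regressor identity turns
    the closed loop into [M s' = - C s - Phi (th - thhat) - mu s - kappa v], the
    skew-symmetry of [M' - 2 C] removes the Coriolis term, and the adaptation law
    cancels the estimation error. *)
Lemma agent_balance (M C dM : 'M[R]_n) (Phi : 'M[R]_(n, p)) (g f a v e de s : 'cV[R]_n)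
    (th thhat : 'cV[R]_p) (alpha mu kappa : R) :
  M^T = M -> skew_symmetric (dM - 2 *: C) -> s = v + alpha *: e ->
  M *m a + C *m v + g = f ->
  f = Phi *m thhat - mu *: s - kappa *: v ->
  Phi *m th = M *m (- alpha *: de) + C *m (- alpha *: e) + g ->
  dot (a + alpha *: de) (M *m s) + dot s (dM *m s + M *m (a + alpha *: de))
  + (dot (Phi^T *m s) (th - thhat) + dot (th - thhat) (Phi^T *m s))
  = - 2 * (mu * dot s s + kappa * dot s v).
Proof.
move=> Msym sk sE plant control reg.
have Ms' : M *m (a + alpha *: de) =
    - (C *m s) - Phi *m (th - thhat) - mu *: s - kappa *: v.
  have Ma : M *m a = f - g - C *m v by rewrite -plant addrK addrK.
  have -> : C *m s = C *m v + alpha *: (C *m e) by rewrite sE mulmxDr -scalemxAr.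
  rewrite mulmxDr Ma control mulmxBr reg -!scalemxAr.
  by apply/matrixP => i j; rewrite !mxE; ring.
have skewE : dot s (dM *m s) = 2 * dot s (C *m s).
  by have := dot_skew s sk; rewrite mulmxBl -scalemxAl dotBr dotZr => /subr0_eq.
rewrite (dot_trmx M) Msym (dotC (M *m _)) (dotDr (dM *m s)) Ms' skewE.
rewrite (dotC (th - thhat)) -!dot_trmx !(dotDr, dotNr, dotZr); ring.
Qed.

End AgentBalance.

Section CouplingSums.
Context {R : realType} (N n : nat) (E : rel 'I_N) (Esym : symmetric E) (rho : R -> R).
Implicit Types q x : 'I_N -> 'cV[R]_n.

(** Relabelling the two ends of each link; this is where [E] must be symmetric. *)
Lemma exchange_edges (V : nmodType) (F : 'I_N -> 'I_N -> V) :
  \sum_(i < N) \sum_(j < N | E i j) F i j = \sum_(i < N) \sum_(j < N | E i j) F j i.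
Proof.
rewrite (exchange_big_dep xpredT)//=; apply: eq_bigr => i _.
by apply: eq_bigl => j; rewrite Esym.
Qed.

(** Summation by parts on the graph.  With [x] the velocities it gives the derivative
    of the potential energy; with [x] the relative positions it bounds the spread
    of the network by the coupling forces. *)
Lemma sum_dot_coupling q x :
  \sum_(i < N) dot (coupling_force E rho q i) (x i) =
  \sum_(i < N) \sum_(j < N | E i j)
     rho (dot (q j - q i) (q j - q i)) * dot (q j - q i) (x j - x i).
Proof.
pose F i j := rho (dot (q j - q i) (q j - q i)) * dot (q i - q j) (x i).
have -> : \sum_(i < N) dot (coupling_force E rho q i) (x i) =
    \sum_(i < N) \sum_(j < N | E i j) F i j + \sum_(i < N) \sum_(j < N | E i j) F i j.
  rewrite -big_split/=; apply: eq_bigr => i _.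
  rewrite dot_suml -big_split/=; apply: eq_bigr => j _; rewrite dotZl /F; ring.
rewrite {2}exchange_edges -big_split/=; apply: eq_bigr => i _.
rewrite -big_split/=; apply: eq_bigr => j _; rewrite /F.
have -> : q i - q j = - (q j - q i) by rewrite opprB.
rewrite !dotNl !dotNr opprK !dotDr !dotNr; ring.
Qed.

End CouplingSums.

Section Lyapunov.
Context {R : realType} (N n : nat) (p : 'I_N -> nat).
Context (E : rel 'I_N) (r : R) (psi : R -> \bar R) (sigma rho : R -> R).
Context (M : 'I_N -> 'cV[R]_n -> 'M[R]_n)
  (C : 'I_N -> 'cV[R]_n -> 'cV[R]_n -> 'M[R]_n)
  (g : 'I_N -> 'cV[R]_n -> 'cV[R]_n) (theta : forall i : 'I_N, 'cV[R]_(p i))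
  (alpha : R)
  (Phi : forall i : 'I_N, 'cV[R]_n -> 'cV[R]_n -> 'cV[R]_n -> 'cV[R]_n ->
         'M[R]_(n, p i))
  (mu kappa : 'I_N -> R).
Context (r0 : 0 < r) (Esym : symmetric E) (prof : potential_profile r psi sigma rho)
  (EL : forall i, euler_lagrange (M i) (C i) (g i)) (alpha0 : 0 < alpha)
  (reg : forall i, regressor alpha (M i) (C i) (g i) (theta i) (Phi i))
  (kappa0 : forall i, 0 < kappa i).

(** The sliding variable [s_i = v_i + alpha e_i]. *)
Definition sliding (q v : 'I_N -> 'cV[R]_n) i : 'cV[R]_n :=
  v i + alpha *: coupling_force E rho q i.

(** Twice the energy of agent [i]: kinetic energy of the sliding variable plus the
    squared estimation error. *)
Definition agent_energy (q v : 'I_N -> 'cV[R]_n) (th : forall i, 'cV[R]_(p i)) i : R :=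
  dot (sliding q v i) (M i (q i) *m sliding q v i) + dot (theta i - th i) (theta i - th i).

(** The weights [1 / kappa i] make the cross terms [- kappa_i s_i . v_i] of all agents
    combine with [alpha] times the derivative of the potential energy, and let the
    initial energies be made negligible by large gains. *)
Definition lyapunov (q v : 'I_N -> 'cV[R]_n) (th : forall i, 'cV[R]_(p i)) : R :=
  alpha * energy E sigma q + \sum_i (2 * kappa i)^-1 * agent_energy q v th i.

Section Limits.
Context T (F : set_system T) {FF : Filter F}.
Context (q v : T -> 'I_N -> 'cV[R]_n) (th : T -> forall i, 'cV[R]_(p i)).
Context (q1 v1 : 'I_N -> 'cV[R]_n) (th1 : forall i, 'cV[R]_(p i)).
Context (qF : forall i, q x i @[x --> F] --> q1 i)
  (vF : forall i, v x i @[x --> F] --> v1 i)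
  (thF : forall i, th x i @[x --> F] --> th1 i).
Context (q1r : in_range E r q1).

Let cvg_diff i j : q x j - q x i @[x --> F] --> q1 j - q1 i.
Proof. by apply: cvgB; exact: qF. Qed.

Let cvg_dist2 i j : dot (q x j - q x i) (q x j - q x i) @[x --> F] -->
  dot (q1 j - q1 i) (q1 j - q1 i).
Proof. by apply: cvg_dot; exact: cvg_diff. Qed.

Lemma cvg_coupling_force i :
  coupling_force E rho (q x) i @[x --> F] --> coupling_force E rho q1 i.
Proof.
apply: cvg_fsum => j Eij; apply: cvgZ; last exact: cvg_diff.
apply: cvgM; first exact: cvg_cst.
apply: (cvg_comp_derivable _ (@cvg_dist2 i j)).
by apply: (profile_slope_derivable prof); apply: dot_lt_sqr => //; exact: q1r.
Qed.

Lemma cvg_lyapunov :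
  lyapunov (q x) (v x) (th x) @[x --> F] --> lyapunov q1 v1 th1.
Proof.
have cs i : sliding (q x) (v x) i @[x --> F] --> sliding q1 v1 i.
  by apply: cvgD; [exact: vF|apply: cvgZr; exact: cvg_coupling_force].
apply: cvgD.
  apply: cvgM; first exact: cvg_cst.
  apply: cvgM; first exact: cvg_cst.
  apply: cvg_fsum => i _; apply: cvg_fsum => j Eij.
  apply: (cvg_comp_derivable _ (@cvg_dist2 i j)).
  by have [] := profile_derive prof (dot_lt_sqr r0 (q1r Eij)).
apply: cvg_fsum => i _; apply: cvgM; first exact: cvg_cst.
apply: cvgD.
  apply: cvg_dot (cs i) _; apply: cvg_mulmx (cs i).
  apply: continuous_cvg; last exact: qF.
  apply: differentiable_continuous.
  by have [+ _] := el_smooth_M (EL i) 1%N; apply.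
by apply: cvg_dot; apply: cvgB; [exact: cvg_cst|exact: thF|exact: cvg_cst|exact: thF].
Qed.

End Limits.

Lemma in_range_near T (F : set_system T) {FF : Filter F} (q : T -> 'I_N -> 'cV[R]_n) q1 :
  (forall i, q x i @[x --> F] --> q1 i) -> in_range E r q1 ->
  \forall x \near F, in_range E r (q x).
Proof.
move=> qF q1r.
have : \forall x \near F, forall ij : 'I_N * 'I_N,
    E ij.1 ij.2 -> enorm (q x ij.2 - q x ij.1) < r.
  apply: filter_forall => -[i j] /=.
  have [Eij|_] := boolP (E i j); last exact: nearW.
  have qij : q x j - q x i @[x --> F] --> q1 j - q1 i by apply: cvgB; exact: qF.
  by apply: filterS (cvgr_lt _ (cvg_enorm qij) _ (q1r _ _ Eij)).
by apply: filterS => x xr i j Eij; exact: (xr (i, j)).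
Qed.

(** * Dissipation along a trajectory *)

Section Trajectory.
Context (T : \bar R) (q v : 'I_N -> R -> 'cV[R]_n)
  (thetahat : forall i : 'I_N, R -> 'cV[R]_(p i)) (f : 'I_N -> R -> 'cV[R]_n).
Context (sol : closed_loop_solution E r psi M C g alpha Phi mu kappa T q v thetahat f).

(* Configuration, velocities and estimates of the whole network at a given time. *)
Local Notation Q := (fun t j => q j t).
Local Notation V := (fun t j => v j t).
Local Notation TH := (fun t j => thetahat j t).

(** Minus the derivative of the Lyapunov function. *)
Definition dissipation (t : R) : R :=
  \sum_i mu i / kappa i * dot (sliding (Q t) (V t) i) (sliding (Q t) (V t) i)
  + \sum_i dot (v i t) (v i t).

(* Times at which the plant and control equations both hold. *)
Section Interior.
Context (t : R) (t0 : 0 < t) (tT : (t%:E < T)%E) (tr : in_range E r (Q t)).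

Let dq i : is_derive t 1 (q i) (v i t).
Proof. by have [] := cl_plant sol i t0 tT. Qed.

Let dQ i j : is_derive t 1 (fun u => q j u - q i u) (v j t - v i t).
Proof. exact: is_derive_fB. Qed.

Let d2 i j := is_derive_dot (@dQ i j) (@dQ i j).

Lemma coupling_force_derivable i : derivable (fun u => coupling_force E rho (Q u) i) t 1.
Proof.
rewrite /coupling_force.
suff H j : E i j -> derivable (fun u => (2 * rho (dot (q j u - q i u) (q j u - q i u)))
    *: (q i u - q j u)) t 1.
  have := @is_derive_fsum _ _ _ _ (E i) (fun j u => (2 * rho (dot (q j u - q i u) (q j u - q i u)))
    *: (q i u - q j u)) _ t 1 (fun j Eij => derivableP (H j Eij)).
  by case.
move=> Eij.
have hrho := derivableP (profile_slope_derivable prof (dot_lt_sqr r0 (tr Eij))).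
have h := is_derive_comp_scalar (g := fun u => dot (q j u - q i u) (q j u - q i u)) hrho (d2 i j).
by have [] := is_derive_scalemx (is_derive_fMl 2 h) (@dQ j i).
Qed.

Lemma near_in_range : \forall u \near t, in_range E r (Q u).
Proof.
apply: (@in_range_near R (nbhs t) _ (fun u j => q j u) (Q t)) => // i.
by have [/derivable1_diffP/differentiable_continuous + _] := dq i; apply.
Qed.

Lemma near_coupling i :
  \forall u \near t, coupling E psi (Q u) i = coupling_force E rho (Q u) i.
Proof. by apply: filterS near_in_range => u ur; exact: (coupling_in_range r0 prof). Qed.

(** The control law only involves [derive1] of the coupling, which is a total
    operator; here it is shown to be a true derivative. *)
Lemma is_derive_coupling_force i :
  is_derive t 1 (fun u => coupling_force E rho (Q u) i)
    (derive1 (fun u => coupling E psi (Q u) i) t).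
Proof.
rewrite derive1E (near_eq_derive _ (near_coupling i)).
exact: derivableP (@coupling_force_derivable i).
Qed.

Lemma is_derive_energy :
  is_derive t 1 (fun u => energy E sigma (Q u))
    (\sum_i dot (coupling_force E rho (Q t) i) (v i t)).
Proof.
have hi i : is_derive t 1
    (fun u => \sum_(j | E i j) sigma (dot (q j u - q i u) (q j u - q i u)))
    (\sum_(j | E i j) rho (dot (q j t - q i t) (q j t - q i t)) *
       (dot (v j t - v i t) (q j t - q i t) + dot (q j t - q i t) (v j t - v i t))).
  apply: is_derive_fsum => j Eij.
  exact: (is_derive_comp_scalar (g := fun u => dot (q j u - q i u) (q j u - q i u))
    (profile_derive prof (dot_lt_sqr r0 (tr Eij))) (d2 i j)).
have H := is_derive_fMl 2^-1
  (is_derive_fsum (P := xpredT) (fun i _ => hi i)).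
apply: (is_derive_eq H); rewrite sum_dot_coupling// mulr_sumr.
apply: eq_bigr => i _; rewrite mulr_sumr; apply: eq_bigr => j _.
by rewrite (dotC (v j t - v i t)); field.
Qed.

Lemma is_derive_agent_energy i :
  is_derive t 1 (fun u => agent_energy (Q u) (V u) (TH u) i)
    (- 2 * (mu i * dot (sliding (Q t) (V t) i) (sliding (Q t) (V t) i)
            + kappa i * dot (sliding (Q t) (V t) i) (v i t))).
Proof.
have [_ va plant] := cl_plant sol i t0 tT.
have [] := cl_control sol i t0 tT tr => /= control dth.
rewrite !(coupling_in_range r0 prof _ tr) in control dth.
pose de := derive1 (fun u => coupling E psi (Q u) i) t.
have ds : is_derive t 1 (fun u => sliding (Q u) (V u) i)
    (derive1 (v i) t + alpha *: de).
  apply: is_derive_fD; first by rewrite derive1E; exact: derivableP.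
  by apply: is_derive_fZ; exact: is_derive_coupling_force.
have dM : is_derive t 1 (fun u => M i (q i u)) ('D_(v i t) (M i) (q i t)).
  apply: is_derive_comp_mx (dq i).
  by have [+ _] := el_smooth_M (EL i) 1%N; apply.
have dtheta := is_derive_fB (is_derive_cst (theta i) t 1) dth.
have H := is_derive_fD (is_derive_dot ds (is_derive_mulmx dM ds)) (is_derive_dot dtheta dtheta).
apply: (is_derive_eq H); rewrite sub0r opprK.
have regt := reg i (q i t) (v i t) (coupling_force E rho (Q t) i) de.
have sE : sliding (Q t) (V t) i = v i t + alpha *: coupling_force E rho (Q t) i by [].
exact: (agent_balance (el_P1_sym (EL i) (q i t)) (el_P2 (EL i) (q i t) (v i t))
  sE plant control regt).
Qed.

Lemma is_derive_lyapunov :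
  is_derive t 1 (fun u => lyapunov (Q u) (V u) (TH u)) (- dissipation t).
Proof.
have H := is_derive_fD (is_derive_fMl alpha is_derive_energy)
  (is_derive_fsum (P := xpredT) (fun i _ =>
     is_derive_fMl (2 * kappa i)^-1 (@is_derive_agent_energy i))).
apply: (is_derive_eq H); rewrite /dissipation mulr_sumr -!big_split/= -sumrN.
apply: eq_bigr => i _; 
have -> : dot (sliding (Q t) (V t) i) (v i t) =
    dot (v i t) (v i t) + alpha * dot (coupling_force E rho (Q t) i) (v i t).
  by rewrite /sliding dotDl dotZl.
field.
by rewrite gt_eqF.
Qed.


End Interior.

Context (mu0 : forall i, 0 < mu i).

Lemma dissipation_ge0 t : 0 <= dissipation t.
Proof.
apply: addr_ge0; apply: sumr_ge0 => i _; last exact: dotxx_ge0.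
by rewrite mulr_ge0 ?dotxx_ge0// divr_ge0// ltW.
Qed.

(** * Preservation of connectivity *)

Lemma inertia_ge i : exists2 l, 0 < l & forall x y : 'cV[R]_n, l * dot y y <= dot y (M i x *m y).
Proof.
have [l [l2 [l0 _ H]]] := el_P1_bounds (EL i); exists l => // x y.
have [/(_ y) + _] := H x; rewrite -mulmxA -/(dot _ _) mulmxBl mul_scalar_mx dotBr dotZr.
by rewrite subr_ge0.
Qed.

Lemma agent_energy_ge0 q1 v1 th1 i : 0 <= agent_energy q1 v1 th1 i.
Proof.
have [l l0 H] := inertia_ge i; rewrite addr_ge0 ?dotxx_ge0//.
by apply: le_trans (H _ _); rewrite mulr_ge0 ?dotxx_ge0// ltW.
Qed.

Lemma energy_le_lyapunov q1 v1 th1 : alpha * energy E sigma q1 <= lyapunov q1 v1 th1.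
Proof.
rewrite lerDl; apply: sumr_ge0 => i _.
by rewrite mulr_ge0 ?agent_energy_ge0// invr_ge0 mulr_ge0// ltW.
Qed.

(** The equations hold at positive times only; the state is right-continuous at 0. *)
Lemma cvg_initial m (h : R -> 'cV[R]_m) :
  {within time_interval T, continuous h} -> h u @[u --> 0^'+] --> h 0.
Proof.
have T0 := cl_T_gt0 sol.
have I0 : time_interval T 0 by split.
move=> /subspace_continuousP/(_ 0 I0) hc A hA.
have H : \forall u \near (0 : R), time_interval T u -> A (h u) := hc _ hA.
suff : \forall u \near (0:R)^'+, A (h u) by [].
have uT : \forall u \near (0:R)^'+, (u%:E < T)%E.
  case: T T0 => [t1| |]//=; last by move=> _; near=> u; rewrite ltry.
  by rewrite lte_fin => t10; near=> u; rewrite lte_fin; near: u; exact: nbhs_right_lt.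
near=> u; have Hu : time_interval T u -> A (h u) by near: u; exact: cvg_within H.
apply: Hu; split; last by near: u.
by apply: ltW; near: u; exact: nbhs_right_gt.
Unshelve. all: by end_near. Qed.

Lemma cvg_q_right i t : 0 <= t -> (t%:E < T)%E -> q i u @[u --> t^'+] --> q i t.
Proof.
rewrite le_eqVlt => /orP[/eqP <- _|t0 tT].
  by have [+ _ _] := cl_continuous sol i; exact: cvg_initial.
apply: cvg_at_right_filter.
by have [[/derivable1_diffP/differentiable_continuous + _] _ _] := cl_plant sol i t0 tT; apply.
Qed.

Lemma cvg_q_left i t : 0 < t -> (t%:E < T)%E -> q i u @[u --> t^'-] --> q i t.
Proof.
move=> t0 tT; apply: cvg_at_left_filter.
by have [[/derivable1_diffP/differentiable_continuous + _] _ _] := cl_plant sol i t0 tT; apply.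
Qed.

Local Notation L := (fun t => lyapunov (Q t) (V t) (TH t)).

Lemma lyapunov_nincr t : 0 <= t -> (t%:E < T)%E ->
  (forall u, 0 <= u <= t -> in_range E r (Q u)) -> L t <= L 0.
Proof.
rewrite le_eqVlt => /orP[/eqP <- //|t0 tT tr].
have dL u : 0 < u <= t -> is_derive u 1 L (- dissipation u).
  move=> /andP[u0 ut]; apply: is_derive_lyapunov => //.
    by apply: le_lt_trans tT; rewrite lee_fin.
  by apply: tr; rewrite ltW.
have [||u _ LE] := @MVT_segment _ L (fun u => - dissipation u) 0 t (ltW t0).
- by move=> u; rewrite in_itv/= => /andP[u0 ut]; apply: dL; rewrite u0 ltW.
- apply/(continuous_within_itvP _ t0); split.
  + move=> u; rewrite in_itv/= => /andP[u0 ut].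
    have [|/derivable1_diffP/differentiable_continuous + _] := dL u; last by apply.
    by rewrite u0 ltW.
  + apply: (@cvg_lyapunov _ _ _ Q V TH (Q 0) (V 0) (TH 0)).
    * by move=> i; apply: cvg_q_right => //; exact: cl_T_gt0 sol.
    * by move=> i; have [_ + _] := cl_continuous sol i; exact: cvg_initial.
    * by move=> i; have [_ _ +] := cl_continuous sol i; exact: cvg_initial.
    * by apply: tr; rewrite lexx ltW.
  + apply: cvg_at_left_filter.
    have [|/derivable1_diffP/differentiable_continuous + _] := dL t; last by apply.
    by rewrite t0 lexx.
rewrite -subr_le0 LE subr0 mulNr oppr_le0 mulr_ge0 ?dissipation_ge0//; exact: ltW.
Qed.

Context (Psimax : \bar R) (gp : generalized_potential n E r psi Psimax).
Context (q0r : in_range E r (Q 0)) (level0 : ((L 0 / alpha)%:E < Psimax)%E).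

Lemma Psi_le_initial t : in_range E r (Q t) -> L t <= L 0 ->
  (Psi E psi (Q t) <= (L 0 / alpha)%:E)%E.
Proof.
move=> tr Lt; rewrite (Psi_in_range prof)// lee_fin ler_pdivlMr// mulrC.
exact: le_trans (energy_le_lyapunov _ _ _) Lt.
Qed.

(** At the first time [t1] at which the configuration is not in range, the potential
    has been at most [L 0 / alpha < Psimax] on all of [[0, t1)], so that the
    configuration at [t1] is in range after all. *)
Lemma always_in_range t : 0 <= t -> (t%:E < T)%E -> in_range E r (Q t).
Proof.
move=> t0 tT; apply: contrapT => tnr.
pose A := [set u | 0 <= u /\ (u%:E < T)%E /\ ~ in_range E r (Q u)].
have At : A t by [].
have Alb u : A u -> 0 <= u by case.
have infA : has_inf A by split; [exists t|exists 0 => u /Alb].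
have hlb : has_lbound A by case: infA.
pose t1 := inf A.
have t1t : t1 <= t by exact: ge_inf.
have t1T : (t1%:E < T)%E by apply: le_lt_trans tT; rewrite lee_fin.
have t10 : 0 <= t1 by apply: lb_le_inf => [|u /Alb]//; exists t.
have before u : 0 <= u < t1 -> in_range E r (Q u).
  move=> /andP[u0 ut1]; apply: contrapT => unr.
  have : t1 <= u.
    by apply: ge_inf => //; split=> //; split=> //; apply: lt_trans t1T; rewrite lte_fin.
  by rewrite leNgt ut1.
(* If [Q t1] is in range, so are the configurations shortly after [t1], and [t1] is not
   the infimum of [A]. *)
have [t1r|t1nr] := pselect (in_range E r (Q t1)).
  have /= [d /= d0 Hd] := in_range_near (fun i => @cvg_q_right i t1 t10 t1T) t1r.
  have [u Au ud] := inf_adherent d0 infA.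
  have t1u : t1 <= u by exact: ge_inf.
  have [_ [_ []]] := Au; move: t1u; rewrite le_eqVlt => /orP[/eqP <- //|t1u].
  apply: (Hd u) => //=.
  by rewrite distrC ger0_norm ?subr_ge0 ?ltW// ltrBlDl.
have t1gt0 : 0 < t1.
  by rewrite lt_neqAle t10 andbT; apply/eqP => t1E; apply: t1nr; rewrite -t1E.
have lim i j : E i j -> enorm (q j u - q i u) @[u --> t1^'-] --> enorm (q j t1 - q i t1).
  by move=> _; apply: cvg_enorm; apply: cvgB; exact: cvg_q_left.
have ev : \forall u \near t1^'-,
    in_range E r (Q u) /\ (Psi E psi (Q u) <= (L 0 / alpha)%:E)%E; last first.
  by apply: t1nr => i j; exact: (limit_in_range gp (qx := Q) (q := Q t1) level0 lim ev).
near=> u.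
have ut1 : u < t1 by near: u; exact: nbhs_left_lt.
have u0 : 0 < u by near: u; exact: nbhs_left_gt.
have ur : in_range E r (Q u) by apply: before; rewrite ltW.
split=> //; apply: Psi_le_initial => //; apply: lyapunov_nincr (ltW u0) _ _.
  by apply: lt_trans t1T; rewrite lte_fin.
by move=> s /andP[s0 su]; apply: before; rewrite s0 (le_lt_trans su).
Unshelve. all: by end_near. Qed.

Lemma lyapunov_le t : 0 <= t -> (t%:E < T)%E -> L t <= L 0.
Proof.
move=> t0 tT; apply: lyapunov_nincr => // u /andP[u0 ut].
by apply: always_in_range => //; apply: le_lt_trans tT; rewrite lee_fin.
Qed.

Context (conn : forall i j, connect E i j).

(** * Uniform bounds along a trajectory *)

Lemma energy_ge0 t : 0 <= t -> (t%:E < T)%E -> 0 <= energy E sigma (Q t).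
Proof.
move=> t0 tT; have tr := always_in_range t0 tT.
by have := Psi_ge0 gp tr; rewrite (Psi_in_range prof)// lee_fin.
Qed.

(** No link length accumulates at [r], on a bounded or unbounded time interval.
    Otherwise some ultrafilter [G] on times makes the length of a link tend to [r];
    positions relative to agent [a] are bounded, hence converge along [G], and the
    limit configuration contradicts [limit_in_range]. *)
Lemma edge_gap a b : E a b -> \forall d \near (0 : R)^'+,
  forall t : R, 0 <= t /\ (t%:E < T)%E -> enorm (q b t - q a t) <= r - d.
Proof.
move=> Eab; apply: contrapT => nearF.
pose B (d : R) := [set t : R | (0 <= t /\ (t%:E < T)%E) /\ r - d < enorm (q b t - q a t)].
have B0 d : 0 < d -> B d !=set0.
  move=> d0; apply: contrapT => /set0P/negP/negPn/eqP Bd0; apply: nearF.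
  near=> d' => t tI; rewrite leNgt; apply/negP => dt.
  suff : B d t by rewrite Bd0.
  split=> //; apply: le_lt_trans dt; rewrite lerD2l lerN2; apply: ltW.
  by near: d'; exact: nbhs_right_lt.
pose F := filter_from [set d : R | 0 < d] B.
have FF : ProperFilter F.
  apply: filter_from_proper => //; apply: filter_from_filter; first by exists 1 => /=.
  move=> d1 d2' /= d10 d20; exists (Num.min d1 d2'); first by rewrite /= lt_min d10.
  move=> t [tI tr]; split; split=> //; apply: le_lt_trans tr.
    by rewrite lerD2l lerN2 ge_min lexx.
  by rewrite lerD2l lerN2 ge_min lexx orbT.
have [G [GU FG]] := ultraFilterLemma FF.
have GB d : 0 < d -> G (B d) by move=> d0; apply: FG; exists d.
have GI : \forall t \near G, in_range E r (Q t) /\ L t <= L 0.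
  apply: filterS (GB 1 ltr01) => t [[t0 tT] _].
  by split; [exact: always_in_range|exact: lyapunov_le].
have zl i : exists l : 'cV[R]_n, q i t - q a t @[t --> G] --> l.
  apply: (@ultra_cvg_mx _ _ _ _ _ _ _ (N%:R * r)) => k j; rewrite ord1.
  by apply: filterS GI => t [tr _]; exact: (connected_coord_le a i k (ltW r0) conn tr).
pose z i := sval (cid (zl i)).
have zP i : q i t - q a t @[t --> G] --> z i := svalP (cid (zl i)).
have lim i j : E i j -> enorm (q j t - q i t) @[t --> G] --> enorm (z j - z i).
  move=> _; apply: cvg_enorm.
  have -> : (fun t => q j t - q i t) = (fun t => (q j t - q a t) - (q i t - q a t)).
    by apply/funext => t; rewrite opprB addrA subrK.
  by apply: cvgB; exact: zP.
have ev : \forall t \near G, in_range E r (Q t) /\ (Psi E psi (Q t) <= (L 0 / alpha)%:E)%E.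
  by apply: filterS GI => t [tr tL]; split=> //; exact: Psi_le_initial.
have GP : ProperFilter G by exact: ultra_proper.
have zr : enorm (z b - z a) < r :=
  limit_in_range gp (FF := GP) (qx := Q) (q := z) level0 lim ev Eab.
pose m := (enorm (z b - z a) + r) / 2.
have zm : enorm (z b - z a) < m by rewrite (midf_lt zr).
have mr : 0 < r - m by rewrite subr_gt0 (midf_lt zr).
have [t [tm [_]]] := filter_ex (filterI (cvgr_lt _ (lim _ _ Eab) _ zm) (GB _ mr)).
by rewrite opprB addrC subrK => /(lt_trans tm); rewrite ltxx.
Unshelve. all: by end_near. Qed.

Lemma uniform_gap : exists2 d, 0 < d < r & forall t, 0 <= t -> (t%:E < T)%E ->
  forall i j, E i j -> enorm (q j t - q i t) <= r - d.
Proof.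
have H : \forall d \near (0:R)^'+, forall ij : 'I_N * 'I_N, E ij.1 ij.2 ->
    forall t, 0 <= t /\ (t%:E < T)%E -> enorm (q ij.2 t - q ij.1 t) <= r - d.
  apply: filter_forall => -[i j] /=; have [Eij|_] := boolP (E i j); last exact: nearW.
  by apply: filterS (edge_gap Eij) => d.
have [d [[d0 dr] Hd]] : exists d : R, (0 < d /\ d < r) /\ forall ij : 'I_N * 'I_N,
    E ij.1 ij.2 -> forall t, 0 <= t /\ (t%:E < T)%E -> enorm (q ij.2 t - q ij.1 t) <= r - d.
  apply: (@filter_ex _ ((0:R)^'+)); apply: filterI => //; apply: filterI.
    exact: nbhs_right_gt.
  exact: nbhs_right_lt.
by exists d => [|t t0 tT i j Eij]; [rewrite d0|exact: (Hd (i, j))].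
Qed.

Lemma slope_bounds : exists lo hi : R, [/\ 0 < lo, 0 < hi &
  forall t, 0 <= t -> (t%:E < T)%E -> forall i j, E i j ->
    lo <= rho (dot (q j t - q i t) (q j t - q i t)) <= hi].
Proof.
have [d /andP[d0 dr] Hd] := uniform_gap.
have rd : 0 <= r - d by rewrite subr_ge0 ltW.
have rd2 : (r - d) ^+ 2 < r ^+ 2.
  by rewrite ltr_sqr ?nnegrE ?(ltW r0)//; rewrite ltrBlDr ltrDl.
have rho_c : {within `[0, (r - d) ^+ 2], continuous rho}.
  apply: derivable_within_continuous => u; rewrite in_itv/= => /andP[u0 ur].
  by apply: (profile_slope_derivable prof); rewrite u0 (le_lt_trans ur).
have [cm cmI Hm] := EVT_min (sqr_ge0 _) rho_c.
have [cM cMI HM] := EVT_max (sqr_ge0 _) rho_c.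
have pos u : u \in `[0, (r - d) ^+ 2]%R -> 0 < rho u.
  rewrite in_itv/= => /andP[u0 ur].
  by apply: (profile_slope_gt0 prof); rewrite u0 (le_lt_trans ur).
exists (rho cm), (rho cM); split; [exact: pos|exact: pos|].
move=> t t0 tT i j Eij.
have I : dot (q j t - q i t) (q j t - q i t) \in `[0, (r - d) ^+ 2]%R.
  by rewrite in_itv/= dotxx_ge0 -(enorm_le _ rd)/=; exact: Hd.
by rewrite Hm// HM.
Qed.

Lemma coupling_bounded : exists2 b, 0 <= b & forall i t, 0 <= t /\ (t%:E < T)%E ->
  dot (coupling_force E rho (Q t) i) (coupling_force E rho (Q t) i) <= b.
Proof.
have [lo [hi [lo0 hi0 H]]] := slope_bounds.
pose c := 2 * hi * (N%:R * r).
have c0 : 0 <= c by rewrite !mulr_ge0// ltW.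
exists (n%:R * (N%:R * c) ^+ 2); first by rewrite mulr_ge0 ?sqr_ge0.
move=> i t [t0 tT]; apply: dot_le_coord => k; rewrite summxE.
apply: le_trans (ler_norm_sum _ _ _) _.
apply: (@le_trans _ _ (\sum_(j < N) c)); last first.
  by rewrite sumr_const card_ord mulr_natl.
rewrite big_mkcond/=; apply: ler_sum => j _; case: ifPn => // Eij.
have /andP[lorho rhohi] := H t t0 tT i j Eij.
have rho0 := lt_le_trans lo0 lorho.
rewrite mxE normrM ger0_norm ?mulr_ge0// ?(ltW rho0)//.
apply: ler_pM => //; first by rewrite mulr_ge0// ltW.
  by rewrite ler_pM2l.
exact: (connected_coord_le j i k (ltW r0) conn (always_in_range t0 tT)).
Qed.

Lemma agent_energy_le i t : 0 <= t -> (t%:E < T)%E ->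
  agent_energy (Q t) (V t) (TH t) i <= 2 * kappa i * L 0.
Proof.
move=> t0 tT; have k0 : 0 < 2 * kappa i by rewrite mulr_gt0.
rewrite -ler_pdivrMl//; apply: le_trans (lyapunov_le t0 tT).
rewrite /lyapunov (bigD1 i)//= addrCA lerDl addr_ge0//.
  by rewrite mulr_ge0 ?energy_ge0// ltW.
apply: sumr_ge0 => j _.
by rewrite mulr_ge0 ?agent_energy_ge0// invr_ge0 mulr_ge0// ltW.
Qed.

Lemma velocity_bounded : exists2 b, 0 <= b & forall i t, 0 <= t /\ (t%:E < T)%E ->
  dot (v i t) (v i t) <= b.
Proof.
have [be be0 He] := coupling_bounded.
apply: finite_upper_bound => i; have [l l0 Hl] := inertia_ge i.
exists (2 * (2 * kappa i * L 0 / l + alpha ^+ 2 * be)) => t [t0 tT].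
have vE : v i t = sliding (Q t) (V t) i - alpha *: coupling_force E rho (Q t) i.
  by rewrite /sliding addrK.
rewrite vE; apply: le_trans (dot_sqrB_le _ _) _.
rewrite ler_pM2l// lerD//; last first.
  by rewrite dotZl dotZr mulrA -expr2 ler_pM2l ?exprn_gt0//; exact: He.
rewrite ler_pdivlMr// mulrC; apply: le_trans (Hl (q i t) _) _.
apply: le_trans (agent_energy_le i t0 tT).
by rewrite lerDl dotxx_ge0.
Qed.

Lemma estimate_bounded : exists2 b, 0 <= b & forall i t, 0 <= t /\ (t%:E < T)%E ->
  dot (thetahat i t) (thetahat i t) <= b.
Proof.
apply: (finite_upper_bound (f := fun i t => dot (thetahat i t) (thetahat i t))) => i.
exists (2 * (dot (theta i) (theta i) + 2 * kappa i * L 0)) => t [t0 tT].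
have -> : thetahat i t = theta i - (theta i - thetahat i t) by rewrite subKr.
apply: le_trans (dot_sqrB_le _ _) _; rewrite ler_pM2l// lerD2l.
apply: le_trans (agent_energy_le i t0 tT).
rewrite lerDr; have [l l0 Hl] := inertia_ge i.
by apply: le_trans (Hl _ _); rewrite mulr_ge0 ?dotxx_ge0// ltW.
Qed.

(** * Consensus *)

(** The sum of the squared link lengths, each undirected link being counted twice. *)
Definition spread (t : R) : R :=
  \sum_(i < N) \sum_(j < N | E i j) dot (q j t - q i t) (q j t - q i t).

(** Since [alpha e_i = s_i - v_i], the dissipation controls the coupling forces. *)
Lemma dissipation_coupling : exists2 c, 0 < c & forall t,
  c * \sum_i dot (coupling_force E rho (Q t) i) (coupling_force E rho (Q t) i)
    <= dissipation t.
Proof.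
have [c [c0 c1 Hc]] : exists c : R, [/\ 0 < c, c < 1 & forall i, c <= mu i / kappa i].
  apply: (@filter_ex _ ((0 : R)^'+)).
  have Hc : \forall c \near (0 : R)^'+, forall i, c <= mu i / kappa i.
    apply: filter_forall => i; near=> c; apply: ltW; near: c.
    by apply: nbhs_right_lt; rewrite divr_gt0.
  near=> c; split; last by near: c.
    by near: c; exact: nbhs_right_gt.
  by near: c; exact: nbhs_right_lt.
exists (c * (alpha ^+ 2 / 2)); first by rewrite mulr_gt0 ?divr_gt0 ?exprn_gt0.
move=> t; rewrite /dissipation -big_split/= mulr_sumr; apply: ler_sum => i _.
set s := sliding _ _ i; set e := coupling_force _ _ _ i.
have H : alpha ^+ 2 / 2 * dot e e <= dot s s + dot (v i t) (v i t).
  have : alpha *: e = s - v i t by rewrite /s /sliding addrC addKr.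
  move=> sE; have := dot_sqrB_le s (v i t); rewrite -sE dotZl dotZr; lra.
apply: (@le_trans _ _ (c * (dot s s + dot (v i t) (v i t)))).
  by rewrite -[leLHS]mulrA ler_pM2l.
rewrite mulrDr lerD//; first by rewrite ler_wpM2r ?dotxx_ge0.
by rewrite ler_piMl ?dotxx_ge0// ltW.
Unshelve. all: by end_near. Qed.

(** A network that is not close to consensus dissipates at a definite rate: the
    coupling forces [e_i] satisfy [lo * spread <= \sum_i e_i . (q_i - q_i0)], where
    the relative positions are bounded and the [e_i] are controlled by the
    dissipation. *)
Lemma dissipation_spread (i0 : 'I_N) (e : R) : 0 < e ->
  exists2 c, 0 < c & forall t, 0 <= t -> (t%:E < T)%E ->
    e <= spread t -> c <= dissipation t.
Proof.
move=> e0; have [c c0 Hc] := dissipation_coupling.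
have [lo [hi [lo0 _ Hlo]]] := slope_bounds.
pose D1 : R := n%:R * (N%:R * r) ^+ 2; pose D : R := N%:R * D1.
have D0 : 0 <= D by apply: mulr_ge0 => //; apply: mulr_ge0 => //; exact: sqr_ge0.
(* The weight in Young's inequality, small enough that the position term [eta * D]
   takes at most half of [2 * (lo * e)]. *)
pose eta := lo * e / (D + 1).
have D1gt : 0 < D + 1 by rewrite ltr_wpDl.
have eta0 : 0 < eta by rewrite divr_gt0// mulr_gt0.
exists (c * (eta * (lo * e))); first by rewrite mulr_gt0// mulr_gt0// mulr_gt0.
move=> t t0 tT et; apply: le_trans (Hc t); rewrite ler_pM2l//.
set S := \sum_i _.
have tr := always_in_range t0 tT.
have lower : lo * e <= \sum_i dot (coupling_force E rho (Q t) i) (q i t - q i0 t).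
  rewrite sum_dot_coupling//; apply: (@le_trans _ _ (lo * spread t)).
    by rewrite ler_pM2l.
  rewrite /spread mulr_sumr; apply: ler_sum => i _.
  rewrite mulr_sumr; apply: ler_sum => j Eij.
  have -> : q j t - q i0 t - (q i t - q i0 t) = q j t - q i t by rewrite opprB addrA subrK.
  by apply: ler_wpM2r; [exact: dotxx_ge0|have /andP[] := Hlo t t0 tT i j Eij].
have upper : 2 * \sum_i dot (coupling_force E rho (Q t) i) (q i t - q i0 t)
    <= eta * D + eta^-1 * S.
  have -> : eta * D = \sum_(i < N) eta * D1.
    by rewrite sumr_const card_ord -mulr_natl /D; ring.
  rewrite /S !mulr_sumr -big_split/=; apply: ler_sum => i _.
  rewrite dotC; apply: le_trans (dot_young _ _ eta0) _; rewrite lerD2r ler_pM2l//.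
  apply: dot_le_coord => k; exact: (connected_coord_le i0 i k (ltW r0) conn tr).
have etaD : eta * D <= lo * e.
  rewrite /eta mulrAC ler_pdivrMr// ler_pM2l ?mulr_gt0//; lra.
have : lo * e <= eta^-1 * S by lra.
by rewrite ler_pdivlMl.
Qed.

Lemma is_derive_spread (t : R) : 0 < t -> (t%:E < T)%E -> is_derive t 1 spread
  (\sum_(i < N) \sum_(j < N | E i j) 2 * dot (v j t - v i t) (q j t - q i t)).
Proof.
move=> t0 tT.
apply: is_derive_fsum => i _; apply: is_derive_fsum => j _.
have dq k : is_derive t 1 (q k) (v k t) by have [] := cl_plant sol k t0 tT.
have d := is_derive_fB (dq j) (dq i).
by apply: (is_derive_eq (is_derive_dot d d)); rewrite dotC; ring.
Qed.

Lemma spread_lipschitz : exists2 b : R, 0 < b & forall s t : R, 0 < s -> s <= t -> (t%:E < T)%E ->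
  spread s - spread t <= b * (t - s).
Proof.
have [bv bv0 Hbv] := velocity_bounded.
pose c := 4 * bv + r ^+ 2.
have c0 : 0 < c by rewrite ltr_wpDl ?mulr_ge0 ?exprn_gt0.
pose b : R := N%:R * (N%:R * c) + 1.
exists b; first by rewrite ltr_wpDl// !mulr_ge0// ltW.
move=> s t s0 st tT.
have bound (u : R) : 0 < u -> u <= t ->
    - (\sum_(i < N) \sum_(j < N | E i j) 2 * dot (v j u - v i u) (q j u - q i u)) <= b.
  move=> u0 ut; have uT : (u%:E < T)%E by apply: le_lt_trans tT; rewrite lee_fin.
  have ur := always_in_range (ltW u0) uT.
  apply: (@le_trans _ _ (\sum_(i < N) \sum_(j < N) c)); last first.
    by rewrite !sumr_const !card_ord -(mulr_natl c) -(mulr_natl (_ * c)) /b lerDl.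
  rewrite -sumrN; apply: ler_sum => i _; rewrite -sumrN big_mkcond/=.
  apply: ler_sum => j _; case: ifPn => [Eij|_]; last exact: ltW.
  rewrite -mulrN -dotNl; apply: le_trans (dot_young _ _ ltr01) _.
  rewrite invr1 !mul1r dotNl dotNr opprK; apply: lerD.
    apply: le_trans (dot_sqrB_le _ _) _.
    have := Hbv i u (conj (ltW u0) uT); have := Hbv j u (conj (ltW u0) uT); lra.
  by apply: ltW; rewrite -enorm_lt ?(ltW r0)//; exact: ur.
have [||u uI LE] := @MVT_segment _ spread
    (fun u => \sum_(i < N) \sum_(j < N | E i j) 2 * dot (v j u - v i u) (q j u - q i u))
    s t st.
- move=> u; rewrite in_itv/= => /andP[su ut].
  apply: is_derive_spread; first exact: lt_trans su.
  by apply: lt_trans tT; rewrite lte_fin.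
- apply: derivable_within_continuous => u; rewrite in_itv/= => /andP[su ut].
  have uT : (u%:E < T)%E by apply: le_lt_trans tT; rewrite lee_fin.
  by have [] := is_derive_spread (lt_le_trans s0 su) uT.
rewrite -opprB LE -mulNr ler_wpM2r ?subr_ge0//.
by move: uI; rewrite in_itv/= => /andP[su ut]; apply: bound => //; exact: lt_le_trans su.
Qed.

Lemma spread_cvg0 (i0 : 'I_N) : T = +oo%E -> spread t @[t --> +oo] --> (0 : R).
Proof.
move=> Too; have fT (t : R) : (t%:E < T)%E by rewrite Too ltry.
have [b b0 Hb] := spread_lipschitz.
have dL (t : R) : 0 < t -> is_derive t 1 L (- dissipation t).
  by move=> t0; apply: is_derive_lyapunov => //; apply: always_in_range => //; exact: ltW.
have dLE (t : R) : 0 < t -> derive1 L t = - dissipation t.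
  by move=> t0; rewrite derive1E; have [_ ->] := dL t t0.
apply: (@lyapunov_decay_cvg0 _ L spread b b0).
- by move=> t t0; have [] := dL t t0.
- move=> t t0; apply: le_trans (energy_le_lyapunov _ _ _).
  by rewrite mulr_ge0 ?energy_ge0// ltW.
- by move=> t t0; rewrite dLE// oppr_le0 dissipation_ge0.
- by move=> t _; apply: sumr_ge0 => i _; apply: sumr_ge0 => j _; exact: dotxx_ge0.
- by move=> s t s0 st; exact: Hb.
- move=> e e0; have [c c0 Hc] := dissipation_spread i0 e0; exists c => // t t0 et.
  by rewrite dLE// lerN2; apply: Hc => //; exact: ltW.
Qed.

Lemma dist2_le_spread t i j : E i j -> dot (q j t - q i t) (q j t - q i t) <= spread t.
Proof.
move=> Eij; rewrite /spread (bigD1 i)//= (bigD1 j)//= -addrA lerDl addr_ge0//.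
  by apply: sumr_ge0 => k _; exact: dotxx_ge0.
by apply: sumr_ge0 => k _; apply: sumr_ge0 => l _; exact: dotxx_ge0.
Qed.

Lemma consensus i j : T = +oo%E -> q i t - q j t @[t --> +oo] --> (0 : 'cV[R]_n).
Proof.
move=> Too; apply: (connected_cvg0 (q := Q) conn) => a b Eab.
apply/cvg_mxP => k l; rewrite ord1 mxE; apply/cvgrPdist_lt => /= e e0.
have sp : \forall t \near +oo, spread t < e ^+ 2.
  exact: (cvgr_lt _ (spread_cvg0 a Too) _ (exprn_gt0 2 e0)).
apply: filterS sp => t te; rewrite sub0r normrN.
rewrite -ltr_sqr ?nnegrE// ?(ltW e0)// real_normK ?num_real//.
exact: le_lt_trans (sqr_coord_le _ _) (le_lt_trans (dist2_le_spread t Eab) te).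
Qed.

Lemma position_bounded t1 : T = t1%:E -> exists2 b, 0 <= b & forall i t,
  0 <= t /\ (t%:E < T)%E -> dot (q i t) (q i t) <= b.
Proof.
move=> TE; have [bv bv0 Hbv] := velocity_bounded.
apply: (finite_upper_bound (f := fun i t => dot (q i t) (q i t))) => i.
exists (n%:R * (enorm (q i 0) + Num.sqrt bv * t1) ^+ 2) => t [t0 tT].
apply: dot_le_coord => k.
have tt1 : t <= t1 by move: tT; rewrite TE lte_fin => /ltW.
have [<-|tn0] := eqVneq 0 t.
  rewrite ler_wpDr ?coord_le_enorm// mulr_ge0 ?sqrtr_ge0//; exact: le_trans tt1.
have tgt0 : 0 < t by rewrite lt_neqAle tn0.
have dqk (u : R) : 0 < u -> u <= t -> is_derive u 1 (fun w => q i w k 0) (v i u k 0).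
  move=> u0 ut; have uT : (u%:E < T)%E by apply: le_lt_trans tT; rewrite lee_fin.
  by have [/is_derive_mxP + _ _] := cl_plant sol i u0 uT; apply.
have [||u uI LE] := @MVT _ (fun w => q i w k 0) (fun u => v i u k 0) 0 t tgt0.
- by move=> u; rewrite in_itv/= => /andP[u0 ut]; apply: dqk => //; exact: ltW.
- apply/(continuous_within_itvP _ tgt0); split.
  + move=> u; rewrite in_itv/= => /andP[u0 ut].
    have [|/derivable1_diffP/differentiable_continuous + _] := dqk u u0; last by apply.
    exact: ltW.
  + by have /cvg_mxP := @cvg_q_right i 0 (lexx 0) (cl_T_gt0 sol); apply.
  + apply: cvg_at_left_filter.
    by have [/derivable1_diffP/differentiable_continuous + _] := dqk t tgt0 (lexx t); apply.
move: uI; rewrite in_itv/= => /andP[u0 ut].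
have -> : q i t k 0 = q i 0 k 0 + v i u k 0 * t.
  by move: LE; rewrite subr0 => <-; rewrite addrC subrK.
apply: le_trans (ler_normD _ _) _; apply: lerD; first exact: coord_le_enorm.
rewrite normrM (ger0_norm t0); apply: ler_pM => //.
apply: le_trans (coord_le_enorm _ _) _; rewrite enorm_sqrt ler_wsqrtr//.
by apply: Hbv; split; [exact: ltW|apply: lt_trans tT; rewrite lte_fin].
Qed.

Lemma preserves_connectivity_and_reaches_consensus :
  connectivity_preserving_consensus E r T q v thetahat.
Proof.
split.
- by move=> t t0 tT i j Eij; rewrite enormB; exact: (always_in_range t0 tT).
- by move=> Too i j; exact: consensus.
- move=> Tfin; have T0 := cl_T_gt0 sol.
  have [t1 TE] : exists t1, T = t1%:E.
    by move: T0 Tfin; case: T => [t1| |]//; exists t1.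
  have [d /andP[d0 _] Hd] := uniform_gap.
  have [bq bq0 Hq] := position_bounded TE.
  have [bv bv0 Hv] := velocity_bounded.
  have [bt bt0 Ht] := estimate_bounded.
  exists (Num.sqrt bq + Num.sqrt bv + Num.sqrt bt), d; split=> // t t0 tT.
  split=> [i|i j Eij]; last by rewrite enormB; exact: Hd.
  have tI := conj t0 tT.
  have := ler_wsqrtr (Hq i t tI); have := ler_wsqrtr (Hv i t tI).
  have := ler_wsqrtr (Ht i t tI); have := sqrtr_ge0 bq; have := sqrtr_ge0 bv.
  have := sqrtr_ge0 bt; rewrite !enorm_sqrt; split; lra.
Qed.

End Trajectory.
End Lyapunov.

(** * The closed loop *)

(** With large gains the Lyapunov function is as close as desired to [alpha] times
    the potential energy, since [agent_energy] does not involve the gains. *)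
Lemma lyapunov_high_gain (R : realType) (N n : nat) (p : 'I_N -> nat) (E : rel 'I_N)
    (sigma rho : R -> R) (M : 'I_N -> 'cV[R]_n -> 'M[R]_n)
    (theta : forall i : 'I_N, 'cV[R]_(p i)) (alpha : R) (q v : 'I_N -> 'cV[R]_n)
    (th : forall i : 'I_N, 'cV[R]_(p i)) (b : R) :
  (forall i, 0 <= agent_energy E rho M theta alpha q v th i) ->
  alpha * energy E sigma q < b ->
  exists2 kappa_min : R, 0 < kappa_min &
    forall kappa : 'I_N -> R, (forall i, kappa_min <= kappa i) ->
    lyapunov E sigma rho M theta alpha kappa q v th < b.
Proof.
move=> a0 eb; set a := agent_energy E rho M theta alpha q v th in a0 *.
pose gap := b - alpha * energy E sigma q.
have gap0 : 0 < gap by rewrite subr_gt0.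
have S0 : 0 <= \sum_i a i by exact: sumr_ge0.
have S10 : 0 < \sum_i a i + 1 by rewrite ltr_wpDl.
exists ((\sum_i a i + 1) / gap) => [|kappa Hk]; first by rewrite divr_gt0.
rewrite /lyapunov -/a -ltrBrDl -/gap.
apply: (@le_lt_trans _ _ (gap / (\sum_i a i + 1) * \sum_i a i)).
  rewrite mulr_sumr; apply: ler_sum => i _; apply: ler_wpM2r => //.
  have k0 : 0 < kappa i by apply: lt_le_trans (Hk i); rewrite divr_gt0.
  rewrite -[leRHS]invrK invf_div lef_pV2 ?posrE ?divr_gt0 ?mulr_gt0//.
  by apply: le_trans (Hk i) _; rewrite ler_peMl ?ler1n// ltW.
rewrite mulrAC ltr_pdivrMr// ltr_pM2l//; lra.
Qed.

Theorem mainTheorem6 (R : realType) (N n : nat) (p : 'I_N -> nat)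
    (E : rel 'I_N) (r : R) (psi : R -> \bar R) (Psimax : \bar R)
    (M : 'I_N -> 'cV[R]_n -> 'M[R]_n)
    (C : 'I_N -> 'cV[R]_n -> 'cV[R]_n -> 'M[R]_n)
    (g : 'I_N -> 'cV[R]_n -> 'cV[R]_n)
    (theta : forall i : 'I_N, 'cV[R]_(p i))
    (alpha : R)
    (Phi : forall i : 'I_N, 'cV[R]_n -> 'cV[R]_n -> 'cV[R]_n -> 'cV[R]_n ->
           'M[R]_(n, p i))
    (q0 v0 : 'I_N -> 'cV[R]_n) (thetahat0 : forall i : 'I_N, 'cV[R]_(p i)) :
  0 < r ->
  symmetric E ->
  (forall i j, connect E i j) ->
  generalized_potential n E r psi Psimax ->
  (forall i, euler_lagrange (M i) (C i) (g i)) ->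
  0 < alpha ->
  (forall i, regressor alpha (M i) (C i) (g i) (theta i) (Phi i)) ->
  (exists2 eps : R, 0 < eps &
     forall i j, E i j -> enorm (q0 j - q0 i) <= r - eps) ->
  (Psi E psi q0 < Psimax)%E ->
  (Psimax = +oo%E ->
     forall mu kappa : 'I_N -> R,
     (forall i, 0 < mu i) -> (forall i, 0 < kappa i) ->
     achieves_consensus E r psi M C g alpha Phi mu kappa q0 v0 thetahat0)
  /\
  ((Psimax < +oo)%E ->
     exists2 kappa_min : R, 0 < kappa_min &
     forall mu kappa : 'I_N -> R,
     (forall i, 0 < mu i) -> (forall i, kappa_min <= kappa i) ->
     achieves_consensus E r psi M C g alpha Phi mu kappa q0 v0 thetahat0).
Proof.
move=> r0 Esym conn gp EL alpha0 reg [eps eps0 q0eps] Psiq0.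
have [sigma prof] := generalized_potential_profile gp.
have q0r : in_range E r q0.
  by move=> i j Eij; apply: le_lt_trans (q0eps _ _ Eij) _; rewrite ltrBlDr ltrDl.
pose L0 kappa := lyapunov E sigma (derive1 sigma) M theta alpha kappa q0 v0 thetahat0.
have core mu kappa : (forall i, 0 < mu i) -> (forall i, 0 < kappa i) ->
    ((L0 kappa / alpha)%:E < Psimax)%E ->
    achieves_consensus E r psi M C g alpha Phi mu kappa q0 v0 thetahat0.
  move=> mu0 kappa0 L0P T q v thetahat f sol init.
  have qE : (fun i => q i 0) = q0 by apply/funext => i; have [] := init i.
  have vE : (fun i => v i 0) = v0 by apply/funext => i; have [] := init i.
  have tE : (fun i => thetahat i 0) = thetahat0.
    by apply: functional_extensionality_dep => i; have [] := init i.
  apply: (preserves_connectivity_and_reaches_consensus r0 Esym prof EL alpha0 reg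
    kappa0 sol mu0 gp _ _ conn); first by rewrite qE.
  by rewrite qE vE tE.
split=> [Poo mu kappa mu0 kappa0|Pfin]; first by apply: core => //; rewrite Poo ltry.
have [P PE] : exists P, Psimax = P%:E.
  by move: (gp_Psimax_gt0 gp) Pfin; case: (Psimax) => [P| |]//; exists P.
have eP : alpha * energy E sigma q0 < alpha * P.
  by rewrite ltr_pM2l// -lte_fin -(Psi_in_range prof q0r) -PE.
have [kmin kmin0 Hk] := lyapunov_high_gain
  (agent_energy_ge0 E (derive1 sigma) theta alpha EL q0 v0 thetahat0) eP.
exists kmin => // mu kappa mu0 kappaP; apply: core => //.
  by move=> i; exact: lt_le_trans (kappaP i).
by rewrite PE lte_fin ltr_pdivrMr// mulrC; exact: Hk.
Qed.
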